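(* There exists $C>0$ such that for every $\psi=\varphi+u+iv\in\Sigma\cap\mathcal{H}$ ($u,v$ real-valued) satisfying $$(\varphi,u)_{\mathcal{H}}=0,\quad(\varphi',u)_{\mathcal{H}}=0,\quad(\varphi,v)_{\mathcal{H}}=0,\quad(\varphi',v)_{\mathcal{H}}=0,$$ we have $$\Lambda(\varphi+u+iv)-\Lambda(\varphi)\ge C\left(\|u\|_{\mathcal{H}^1_-}^2+\|v\|_{\mathcal{H}^1_-}^2+\|\eta\|_{L^2}^2\right),$$ where $\eta=|\varphi+u+iv|^2-\varphi^2=2\varphi u+u^2+v^2$.
   Context: $\varphi(x)=\tanh(x)$, so $\varphi'=1-\varphi^2=\mathrm{sech}^2(x)$. $\Lambda(\psi)=\int_{\mathbb{R}}\left[|\psi_x|^2+(1-|\psi|^2)^2\right]dx$. $\Sigma=\{\psi\in H^1_{\rm loc}(\mathbb{R}):\psi_x\in L^2(\mathbb{R}),\ 1-|\psi|^2\in L^2(\mathbb{R})\}$. $\mathcal{H}=\{f\in L^2_{\rm loc}(\mathbb{R}):\sqrt{1-\varphi^2}f\in L^2(\mathbb{R})\}$ with inner product $(f,g)_{\mathcal{H}}=\int_{\mathbb{R}}(1-\varphi^2)\bar fg\,dx$ and induced norm $\|\cdot\|_{\mathcal{H}}$. $\mathcal{H}^1_-=\{f\in\mathcal{H}:f'\in L^2(\mathbb{R})\}$ with $\|f\|_{\mathcal{H}^1_-}^2=\|f\|_{\mathcal{H}}^2+\|f'\|_{L^2}^2$. *)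

(* Defs.v *)
From HB Require Import structures.
From mathcomp Require Import all_boot all_order all_algebra.
From mathcomp Require Import all_classical all_reals all_analysis.
From mathcomp Require Export complex.
Set Implicit Arguments.
Unset Strict Implicit.
Unset Printing Implicit Defensive.
Import Order.TTheory GRing.Theory Num.Theory.
Import numFieldNormedType.Exports.
Local Open Scope classical_set_scope.
Local Open Scope complex_scope.
Local Open Scope ring_scope.

Section Defs.
Context {R : realType}.

Local Notation mu := (@lebesgue_measure R).

(* Elements of the function spaces are represented by Borel functions on the
   line, which is harmless: every Lebesgue measurable function agrees almost
   everywhere with a Borel one, and everything below is invariant under
   modification on a null set. *)

Definition cmeasurable (f : R -> R[i]) : Prop :=
  measurable_fun setT (fun x => complex.Re (f x)) /\
  measurable_fun setT (fun x => complex.Im (f x)).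

Definition cintegral (f : R -> R[i]) : R[i] :=
  (\int[mu]_(x in setT) complex.Re (f x)) +i* (\int[mu]_(x in setT) complex.Im (f x)).

Definition cof (f : R -> R) : R -> R[i] := fun x => (f x)%:C.

(* Squared norms take values in [\bar R], so an infinite norm is +oo. *)
Definition sqnormL2 (D : set R) (f : R -> R[i]) : \bar R :=
  (\int[mu]_(x in D) (Normc.normc (f x) ^+ 2)%:E)%E.

Definition inL2 (f : R -> R[i]) : Prop :=
  cmeasurable f /\ (sqnormL2 setT f < +oo)%E.

Definition inL2loc (f : R -> R[i]) : Prop :=
  cmeasurable f /\ forall K : set R, compact K -> (sqnormL2 K f < +oo)%E.

Definition inL1loc (f : R -> R[i]) : Prop :=
  locally_integrable setT (fun x => complex.Re (f x)) /\
  locally_integrable setT (fun x => complex.Im (f x)).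

(* Real-valued C_c^oo functions; they suffice to test complex-valued
   distributions, by linearity. *)
Definition test_function (theta : R -> R) : Prop :=
  (forall (n : nat) (x : R), derivable (derive1n n theta) x 1) /\
  (exists M : R, forall x : R, M < `|x| -> theta x = 0).

Definition is_weak_derivative (f g : R -> R[i]) : Prop :=
  [/\ inL1loc f, inL1loc g &
      forall theta : R -> R, test_function theta ->
        cintegral (fun x => f x * (derive1 theta x)%:C) =
        - cintegral (fun x => g x * (theta x)%:C)].

(* The weak derivative, unique up to a null set when it exists; [wderiv f] is 0
   for an [f] without weak derivative. *)
Definition wderiv (f : R -> R[i]) : R -> R[i] :=
  xget (fun=> 0) [set g | is_weak_derivative f g].

Definition inH1loc (f : R -> R[i]) : Prop :=
  inL2loc f /\ exists2 g, is_weak_derivative f g & inL2loc g.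

(* The hyperbolic tangent. *)
Definition phi (x : R) : R :=
  (expR x - expR (- x)) / (expR x + expR (- x)).

Definition Lambda (psi : R -> R[i]) : \bar R :=
  (\int[mu]_(x in setT)
     (Normc.normc (wderiv psi x) ^+ 2 +
      (1 - Normc.normc (psi x) ^+ 2) ^+ 2)%:E)%E.

Definition inSigma (psi : R -> R[i]) : Prop :=
  [/\ inH1loc psi, inL2 (wderiv psi) &
      inL2 (cof (fun x => 1 - Normc.normc (psi x) ^+ 2))].

Definition inH (f : R -> R[i]) : Prop :=
  inL2loc f /\ inL2 (fun x => (Num.sqrt (1 - phi x ^+ 2))%:C * f x).

Definition innerH (f g : R -> R[i]) : R[i] :=
  cintegral (fun x => (1 - phi x ^+ 2)%:C * conjc (f x) * g x).

(* [innerH f f], as an extended real *)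
Definition sqnormH (f : R -> R[i]) : \bar R :=
  (\int[mu]_(x in setT)
     ((1 - phi x ^+ 2) * Normc.normc (f x) ^+ 2)%:E)%E.

Definition sqnormH1m (f : R -> R[i]) : \bar R :=
  (sqnormH f + sqnormL2 setT (wderiv f))%E.

End Defs.

(* Main.v *)
Require Import Defs.
From mathcomp Require Import all_boot all_order all_algebra.
From mathcomp Require Import all_classical all_reals all_analysis.
From mathcomp Require Import measurable_realfun.
From mathcomp Require Import ring lra.
Import Order.TTheory GRing.Theory Num.Theory.
Import numFieldNormedType.Exports.
Local Open Scope classical_set_scope.
Local Open Scope complex_scope.
Local Open Scope ring_scope.
Set Implicit Arguments.
Unset Strict Implicit.
Unset Printing Implicit Defensive.

(** Write psi = phi + u + i v.  Since phi' = 1 - phi^2 = sech^2 and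
    phi'' = - 2 phi sech^2, expanding the energy and integrating the cross term
    2 phi' u' by parts leaves

      Lambda(psi) - Lambda(phi) = Q(u) + Q(v) + int eta^2,
      Q(f) = int f'^2 - 2 int sech^2 f^2,

    because the terms linear in u are multiples of (phi, u)_H = 0.  So it
    suffices to bound Q(f) from below by D + M, where D = int f'^2 and
    M = int sech^2 f^2, whenever f is orthogonal in H to phi and to phi'
    ([spectral_gap], [coercivity]).

    In the variable y = tanh x one has dy = sech^2 dx, hence
    D = int_{-1}^1 (1 - y^2) f_y^2 dy and M = int_{-1}^1 f^2 dy: the forms of
    the Legendre operator, whose eigenvalues are 0, 2, 6, ...  The value 2 has to
    be beaten.  Orthogonality to phi removes y; orthogonality to phi' removes
    1 - y^2 instead of the constants, which costs a little.

    No spectral theory is needed.  Subtract from f the affine function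
    alpha + beta y that makes the difference h vanish at y = -1/3 and y = 1/3.
    Each x is joined to one of these two nodes, h(x) is the integral of h' between
    them, and the Cauchy-Schwarz inequality with weight sech^2 followed by an
    exchange of integrals gives 3 int sech^2 h^2 <= int h'^2 ([hardy]).  Writing
    both sides in terms of f, with m = int sech^2 f, yields
    D >= 3 M + 6 alpha^2 - 6 alpha m >= 3 M - (3/2) m^2, and orthogonality to phi'
    gives m^2 <= M / 3 ([mean_bound]).  Hence D >= (5/2) M, which is the same as
    D - 2 M >= (D + M) / 7, and C = 1/7 works.

    The rest is regularity.  Only weak derivatives are available, so h(x) has to be
    identified with an integral of h'.  Test functions are built from exp(-1/x);
    they approximate indicators of intervals, which gives uniqueness of weak
    derivatives ([ae0_itv]) and the lemma of du Bois-Reymond ([du_bois_reymond]),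
    so that a function with a weak derivative g is almost everywhere a constant
    plus a primitive of g ([weak_primitive]). *)

(** * Smooth functions *)

Section Smooth.
Context {R : realType}.
Implicit Types (f g : R -> R) (a b x : R) (n k : nat).

Lemma is_deriveMr f g x a b : is_derive x 1 f a -> is_derive x 1 g b ->
  is_derive x 1 (fun y => f y * g y) (a * g x + f x * b).
Proof.
move=> fa gb; have := is_deriveM fa gb.
by rewrite /GRing.scale /= addrC (mulrC (g x)).
Qed.

Lemma is_deriveDr f g x a b : is_derive x 1 f a -> is_derive x 1 g b ->
  is_derive x 1 (fun y => f y + g y) (a + b).
Proof. by move=> fa gb; exact: is_deriveD. Qed.

Lemma is_deriveBr f g x a b : is_derive x 1 f a -> is_derive x 1 g b ->
  is_derive x 1 (fun y => f y - g y) (a - b).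
Proof. by move=> fa gb; exact: is_deriveB. Qed.

Lemma is_deriveNr f x a : is_derive x 1 f a -> is_derive x 1 (fun y => - f y) (- a).
Proof. by move=> fa; exact: is_deriveN. Qed.

Lemma is_deriveVr f x a : f x != 0 -> is_derive x 1 f a ->
  is_derive x 1 (fun y => (f y)^-1) (- a / f x ^+ 2).
Proof.
move=> fx fa; have := is_deriveV fx fa.
by rewrite /GRing.scale /= mulrC mulrN mulNr.
Qed.

Lemma is_derive_compr f g x a b : is_derive (g x) 1 f a -> is_derive x 1 g b ->
  is_derive x 1 (fun y => f (g y)) (a * b).
Proof. by move=> fa gb; exact: is_derive1_comp. Qed.

Lemma is_deriveXr f x a k : is_derive x 1 f a ->
  is_derive x 1 (fun y => f y ^+ k) (k%:R * f x ^+ k.-1 * a).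
Proof.
move=> fa; elim: k => [|k IH].
  by rewrite !mul0r; exact: is_derive_cst.
have -> : (fun y => f y ^+ k.+1) = (fun y => f y * f y ^+ k).
  by apply/funext => y; rewrite exprS.
apply: (is_derive_eq (is_deriveMr fa IH)).
case: k {IH} => [|k] /=; rewrite ?exprS -?natr1; ring.
Qed.

(** Derivatives are carried as witnesses rather than as iterates of [derive1]: the
    closure properties below then follow by induction on the order. *)
Fixpoint diffn n f : Prop :=
  if n is n'.+1 then
    exists2 f' : R -> R, (forall x, is_derive x 1 f (f' x)) & diffn n' f'
  else True.

Definition smooth f := forall n, diffn n f.

Lemma diffnW n f : diffn n.+1 f -> diffn n f.
Proof.
elim: n f => [//|n IH] f [f' ff' /IH f'n]; by exists f'.
Qed.

Lemma diffn_cst n a : diffn n (fun=> a).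
Proof.
elim: n a => [//|n IH] a; exists (fun=> 0) => [x|]; last exact: IH.
exact: is_derive_cst.
Qed.

Lemma diffnD n f g : diffn n f -> diffn n g -> diffn n (fun x => f x + g x).
Proof.
elim: n f g => [//|n IH] f g [f' ff' f'n] [g' gg' g'n].
exists (fun x => f' x + g' x) => [x|]; last exact: IH.
exact: is_deriveDr.
Qed.

Lemma diffnM n f g : diffn n f -> diffn n g -> diffn n (fun x => f x * g x).
Proof.
elim: n f g => [//|n IH] f g fn gn.
have [f' ff' f'n] := fn; have [g' gg' g'n] := gn.
exists (fun x => f' x * g x + f x * g' x) => [x|].
  exact: is_deriveMr.
by apply: diffnD; apply: IH => //; exact: diffnW.
Qed.

Lemma is_derive_affine x a b : is_derive x 1 (fun x : R => a * x + b) a.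
Proof.
apply: (is_derive_eq (is_deriveDr (is_deriveMr (is_derive_cst a x 1)
  (is_derive_id x 1)) (is_derive_cst b x 1))).
by rewrite mul0r add0r mulr1 addr0.
Qed.

Lemma diffn_affine n f a b : diffn n f -> diffn n (fun x => f (a * x + b)).
Proof.
elim: n f => [//|n IH] f [f' ff' f'n].
exists (fun x => a * f' (a * x + b)) => [x|].
  have := @is_derive_compr f (fun x => a * x + b) x _ _ (ff' _) (is_derive_affine x a b).
  by rewrite mulrC.
apply: diffnM; [exact: diffn_cst|exact: IH].
Qed.

Lemma diffn_derive1 n f : diffn n.+1 f -> diffn n (derive1 f).
Proof.
move=> [f' ff' f'n]; suff -> : derive1 f = f' by [].
by apply/funext => x; rewrite derive1E; apply: derive_val.
Qed.

Lemma smooth_derivable n f x : smooth f -> derivable (derive1n n f) x 1.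
Proof.
have aux : forall m, diffn (n + m) f -> diffn m (derive1n n f).
  elim: n => [//|n IH] m fm; rewrite derive1nS.
  by apply: diffn_derive1; apply: IH; rewrite addnS.
by move=> sf; have [f' ff' _] := aux 1%N (sf _); apply: ex_derive.
Qed.

Lemma is_derive_phi x : is_derive x 1 (@phi R) (1 - phi x ^+ 2).
Proof.
have e0 : expR x + expR (- x) != 0 by rewrite gt_eqF// addr_gt0// expR_gt0.
have dN : is_derive x 1 (fun y : R => expR (- y)) (- expR (- x)).
  apply: (is_derive_eq (@is_derive_compr expR (fun y => - y) x _ _ (is_derive_expR (- x))
    (is_deriveNr (is_derive_id x 1)))).
  by rewrite mulrN1.
have dV := @is_deriveVr (fun y => expR y + expR (- y)) x _ e0
  (is_deriveDr (is_derive_expR x) dN).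
apply: (is_derive_eq (is_deriveMr (is_deriveBr (is_derive_expR x) dN) dV)).
rewrite /phi.
by field.
Qed.

Lemma diffn_phi n : diffn n (@phi R).
Proof.
elim: n => [//|n IH]; exists (fun x => 1 - phi x ^+ 2); first exact: is_derive_phi.
have -> : (fun x : R => 1 - phi x ^+ 2) = (fun x => 1 + (-1) * (phi x * phi x)).
  by apply/funext => x; rewrite mulN1r expr2.
apply: diffnD; first exact: diffn_cst.
by apply: diffnM; [exact: diffn_cst|exact: diffnM].
Qed.

(** The functions x^(-k) exp(-1/x), extended by 0 to x <= 0.  Differentiation stays
    inside the span of this family, which is why every member is smooth. *)
Definition flat k x := if 0 < x then x^-1 ^+ k * expR (- x^-1) else 0.

Lemma flat_ge0 k x : 0 <= flat k x.
Proof.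
rewrite /flat; case: ifP => // x0.
by rewrite mulr_ge0// ?expR_ge0// exprn_ge0// invr_ge0 ltW.
Qed.

(** The bound exp(1/x) >= x^(-k-1) / (k+1)! makes [flat k] vanish linearly at 0; applied
    to [flat k.+1], which is [flat k x / x], it gives the derivative at 0. *)
Lemma flat_le k x : flat k x <= k.+1`!%:R * `|x|.
Proof.
rewrite /flat; case: ifP => [x0|_]; last by rewrite mulr_ge0.
rewrite (gtr0_norm x0).
have := @expR_ge1Dxn R x^-1 k; rewrite invr_ge0 => /(_ (ltW x0)) h.
have f0 : (0 : R) < k.+1`!%:R by rewrite ltr0n fact_gt0.
have := expR_gt0 x^-1; rewrite expRN; set e := expR _ in h * => e0.
rewrite ler_pdivrMr//.
have : x^-1 ^+ k.+1 / k.+1`!%:R <= e by apply: le_trans h; rewrite lerDr.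
rewrite ler_pdivrMr// exprS => /(ler_wpM2l (ltW x0)).
rewrite mulrA divff ?gt_eqF// mul1r => /le_trans; apply.
by rewrite mulrCA [x * _]mulrC [e * _]mulrC.
Qed.

Lemma is_derive_flat k x :
  is_derive x 1 (flat k) (flat k.+2 x - k%:R * flat k.+1 x).
Proof.
have [x0|x0|->] := ltgtP x 0.
- apply: (@near_eq_is_derive _ _ _ (cst 0)).
    near=> y; rewrite /flat ifF//; apply/negbTE; rewrite -leNgt ltW//.
    by near: y; exact: lt_nbhsl.
  apply: is_derive_eq; rewrite /flat ltNge (ltW x0)/=.
  by rewrite mulr0 subr0.
- have dV : is_derive x 1 (fun y : R => y^-1) (- x ^- 2).
    apply: (is_derive_eq (is_deriveVr (lt0r_neq0 x0) (is_derive_id x 1))).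
    by rewrite mulNr mul1r.
  apply: (@near_eq_is_derive _ _ _ (fun y : R => (y^-1) ^+ k * expR (- y^-1))).
    near=> y; rewrite /flat ifT//.
    by near: y; exact: lt_nbhsr.
  apply: (is_derive_eq (is_deriveMr (is_deriveXr k dV)
    (@is_derive_compr expR (fun y => - y^-1) x _ _ (is_derive_expR (- x^-1)) (is_deriveNr dV)))).
  rewrite /flat x0 -exprVn.
  case: k => [|k] /=; rewrite ?exprS; ring.
- rewrite /flat ltxx mulr0 subr0.
  have c0 (K : R) : K * `|h| @[h --> (0 : R)^'] --> (0 : R).
    apply: cvg_within_filter.
    have : {for (0 : R), continuous (fun h : R => K * `|h|)}.
      by apply: continuousM; [exact: cst_continuous|exact: norm_continuous].
    by rewrite /prop_for /continuous_at normr0 mulr0.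
  have cv : h^-1 *: (flat k (h + 0) - flat k 0) @[h --> 0^'] --> (0 : R).
    apply: (@squeeze_cvgr _ _ _ _ (fun h : R => - (k.+2`!%:R * `|h|)) (fun h => k.+2`!%:R * `|h|)).
    + near=> h.
      rewrite addr0 [flat k 0]/flat ltxx subr0 -ler_norml normrM.
      have h0 : h != 0 by near: h; exact: nbhs_dnbhs_neq.
      apply: le_trans (flat_le k.+1 h).
      rewrite /flat; case: (ltP 0 h) => hp; last by rewrite normr0 mulr0.
      have h1 : 0 <= h^-1 by rewrite invr_ge0 ltW.
      rewrite ger0_norm// ger0_norm; last by rewrite mulr_ge0// ?expR_ge0// exprn_ge0.
      by rewrite exprS mulrA.
    + have := cvgN (c0 k.+2`!%:R); rewrite oppr0; exact.
    + exact: c0.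
  have cv' : h^-1 *: ((flat k \o shift 0) (h *: 1) - flat k 0) @[h --> 0^'] --> (0 : R).
    by under eq_fun do rewrite /= /GRing.scale /= mulr1.
  by apply: DeriveDef; [apply/cvg_ex; exists 0|apply: cvg_lim].
Unshelve. all: by end_near. Qed.

Lemma diffn_flat n k : diffn n (flat k).
Proof.
elim: n k => [//|n IH] k.
exists (fun x => flat k.+2 x + (- k%:R) * flat k.+1 x) => [x|].
  by rewrite mulNr; exact: is_derive_flat.
by apply: diffnD; [exact: IH|apply: diffnM; [exact: diffn_cst|exact: IH]].
Qed.

End Smooth.

(** * Integrable functions on the line *)

Section RealIntegral.
Context {R : realType}.
Local Notation mu := (@lebesgue_measure R).
Implicit Types (f g w : R -> R) (a b k : R).

Definition L1 f := mu.-integrable setT (EFin \o f).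

Lemma L1_measurable f : L1 f -> measurable_fun setT f.
Proof. by move=> /integrableP[/measurable_EFinP]. Qed.

Lemma integral_EFinR f : L1 f -> (\int[mu]_x (f x)%:E)%E = (\int[mu]_x f x)%:E.
Proof. by move=> fL; rewrite /Rintegral fineK//; exact: integrable_fin_num. Qed.

Lemma L1_dom f g : measurable_fun setT f -> (forall x, `|f x| <= g x) -> L1 g -> L1 f.
Proof.
move=> mf fg gL; apply: le_integrable gL => //; first exact/measurable_EFinP.
by move=> x _ /=; rewrite lee_fin (le_trans (fg x))// ler_norm.
Qed.

Lemma L1_ge0 f : measurable_fun setT f -> (forall x, 0 <= f x) ->
  (\int[mu]_x (f x)%:E < +oo)%E -> L1 f.
Proof.
move=> mf f0 foo; apply/integrableP; split; first exact/measurable_EFinP.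
by under eq_integral do rewrite /= ger0_norm//.
Qed.

Lemma L1_lty f : L1 f -> (\int[mu]_x (f x)%:E < +oo)%E.
Proof. by move=> fL; rewrite integral_EFinR// ltry. Qed.

Lemma eq_L1 f g : f =1 g -> L1 f -> L1 g.
Proof. by move=> /funext ->. Qed.

Lemma eq_I f g : f =1 g -> \int[mu]_x f x = \int[mu]_x g x.
Proof. by move=> /funext ->. Qed.

Lemma L1D f g : L1 f -> L1 g -> L1 (fun x => f x + g x).
Proof. by move=> fL gL; have := integrableD measurableT fL gL; exact. Qed.

Lemma L1Z k f : L1 f -> L1 (fun x => k * f x).
Proof. by move=> fL; have := integrableZl measurableT k fL; exact. Qed.

Lemma L1B f g : L1 f -> L1 g -> L1 (fun x => f x - g x).
Proof. by move=> fL gL; have := integrableB measurableT fL gL; exact. Qed.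

Lemma L1_norm f : L1 f -> L1 (fun x => `|f x|).
Proof. by move=> fL; exact: integrable_norm. Qed.

Lemma ID f g : L1 f -> L1 g ->
  \int[mu]_x (f x + g x) = \int[mu]_x f x + \int[mu]_x g x.
Proof. by move=> fL gL; rewrite RintegralD. Qed.

Lemma IB f g : L1 f -> L1 g ->
  \int[mu]_x (f x - g x) = \int[mu]_x f x - \int[mu]_x g x.
Proof. by move=> fL gL; rewrite RintegralB. Qed.

Lemma IZ k f : L1 f -> \int[mu]_x (k * f x) = k * \int[mu]_x f x.
Proof. by move=> fL; rewrite RintegralZl. Qed.

Lemma I_le f g : L1 f -> L1 g -> (forall x, f x <= g x) ->
  \int[mu]_x f x <= \int[mu]_x g x.
Proof. by move=> fL gL fg; apply: le_Rintegral. Qed.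

Lemma I_dominated (f_ : nat -> R -> R) f g :
  (forall n, measurable_fun setT (f_ n)) ->
  (forall x, f_ n x @[n --> \oo] --> f x) ->
  (forall n x, `|f_ n x| <= g x) -> L1 g ->
  L1 f /\ \int[mu]_x f_ n x @[n --> \oo] --> \int[mu]_x f x.
Proof.
move=> mf_ f_f f_g gL.
have mE n : measurable_fun setT (EFin \o f_ n) by exact/measurable_EFinP.
have cE x : setT x -> (EFin \o f_ n) x @[n --> \oo] --> (EFin \o f) x.
  by move=> _; apply/fine_cvgP; split; [exact: nearW|exact: f_f].
have fE x : setT x -> (EFin \o g) x \is a fin_num by [].
have bE n x : setT x -> (`|(EFin \o f_ n) x| <= (EFin \o g) x)%E.
  by move=> _ /=; rewrite lee_fin.
have fL : L1 f.
  apply/integrableP; split; first exact: (emeasurable_fun_cvg _ _ mE cE).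
  apply: le_lt_trans (L1_lty gL); apply: ge0_le_integral => //.
  - apply: measurableT_comp => //; exact: (emeasurable_fun_cvg _ _ mE cE).
  - by apply/measurable_EFinP; exact: L1_measurable.
  - move=> x _; rewrite lee_fin.
    have : `|f_ n x| @[n --> \oo] --> `|f x| by apply: cvg_norm; exact: f_f.
    by move=> /cvgr_to_le; apply; exact: nearW.
split => //.
have := @dominated_cvg _ _ _ mu _ measurableT _ _ _ mE cE fE gL bE.
by rewrite [X in _ --> X](integral_EFinR fL) => /fine_cvg; exact.
Qed.

Lemma locint_bounded w f a b k : locally_integrable setT w ->
  measurable_fun setT f -> (forall x, `|f x| <= k) ->
  (forall x, ~~ (a <= x <= b) -> f x = 0) -> L1 (fun x => w x * f x).
Proof.
move=> [mw _ wK] mf fk f0.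
have wL : L1 (fun x => `|w x| * \1_(`[a, b]) x).
  apply: L1_ge0 => [|x|].
  - apply: measurable_funM; first exact: measurableT_comp.
    exact: measurable_indic.
  - by rewrite mulr_ge0// indicE.
  have := wK `[a, b]%classic (@subsetT _ _) (@segment_compact _ a b).
  rewrite integral_mkcond; congr (_ < _)%E; apply: eq_integral => x _.
  by rewrite patchE indicE; case: (x \in _); rewrite ?mulr1 ?mulr0.
apply: L1_dom (L1Z k wL) => [|x]; first exact: measurable_funM.
rewrite normrM mulrCA indicE; have [xab|xab] := boolP (a <= x <= b).
  by rewrite mem_set ?mulr1//= ler_wpM2l.
by rewrite f0// normr0 mulr0 memNset ?mulr0//= in_itv /=; exact/negP.
Qed.

Lemma locint_cst k : locally_integrable setT (fun _ : R => k).
Proof.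
split; [exact: measurable_cst|exact: openT|move=> K _ cK].
rewrite integral_cst; last exact: compact_measurable.
by rewrite lte_mul_pinfty// ?lee_fin//; exact: compact_finite_measure.
Qed.

Lemma L1_bounded f a b k : measurable_fun setT f -> (forall x, `|f x| <= k) ->
  (forall x, ~~ (a <= x <= b) -> f x = 0) -> L1 f.
Proof.
move=> mf fk f0; have := locint_bounded (locint_cst 1) mf fk f0.
by apply: eq_L1 => x; rewrite mul1r.
Qed.

Lemma locint_itv w a b : locally_integrable setT w -> L1 (fun x => w x * \1_(`[a, b]) x).
Proof.
move=> wl; apply: (@locint_bounded _ _ a b 1) => // x.
  by rewrite indicE; case: (_ \in _); rewrite ?normr1 ?normr0.
by move=> xab; rewrite indicE memNset//= in_itv/=; exact/negP.
Qed.

End RealIntegral.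

(** * Bump functions and functions that integrate to zero *)

Section Bumps.
Context {R : realType}.
Local Notation mu := (@lebesgue_measure R).
Implicit Types (f g w theta : R -> R) (a b x M : R) (n k : nat).

Lemma smooth_test theta a b : smooth theta ->
  (forall x, ~~ (a <= x <= b) -> theta x = 0) -> test_function theta.
Proof.
move=> st t0; split=> [n x|]; first exact: smooth_derivable.
exists (`|a| + `|b|) => x xab; apply: t0; apply/negP => /andP[ax xb].
move: xab; rewrite ltNge => /negP; apply; rewrite ler_norml; apply/andP; split.
  rewrite opprD (le_trans _ ax)// (le_trans (_ : _ <= - `|a|))//.
    by rewrite lerBlDr lerDl.
  by rewrite lerNl ler_normr lexx orbT.
by rewrite (le_trans xb)// (le_trans (ler_norm b))// lerDr.
Qed.

Lemma smooth_continuous f : smooth f -> continuous f.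
Proof.
move=> sf x; have [f' ff' _] := sf 1%N.
apply: differentiable_continuous; apply/derivable1_diffP.
exact: ex_derive.
Qed.

Lemma smooth_measurable f : smooth f -> measurable_fun setT f.
Proof. by move=> /smooth_continuous; exact: continuous_measurable_fun. Qed.

Lemma flat0_le1 x : flat 0 x <= 1.
Proof.
rewrite /flat; case: ifP => // x0; rewrite expr0 mul1r expR_le1 oppr_le0.
by rewrite invr_ge0 ltW.
Qed.

Lemma flat_le0 k x : x <= 0 -> flat k x = 0.
Proof. by rewrite /flat leNgt => /negbTE ->. Qed.

Lemma flat0_ge x : 0 < x -> 1 - x^-1 <= flat 0 x.
Proof. by move=> x0; rewrite /flat x0 expr0 mul1r expR_ge1Dx. Qed.

Lemma flat0_cvg (u : nat -> R) : u n @[n --> \oo] --> +oo ->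
  flat 0 (u n) @[n --> \oo] --> (1 : R).
Proof.
move=> uoo; have upos : \forall n \near \oo, 0 < u n.
  by move/cvgryPgt : uoo; exact.
apply: (@squeeze_cvgr _ _ _ _ (fun n => 1 - (u n)^-1) (cst 1)).
- by near=> n; rewrite flat0_ge ?flat0_le1//; near: n.
- rewrite -[X in _ --> X]subr0; apply: cvgB; first exact: cvg_cst.
  exact/gtr0_cvgV0.
- exact: cvg_cst.
Unshelve. all: by end_near. Qed.

(** As k grows, exp(-1/(k (x - a))) and exp(-1/(k (b - x))) tend to 1 on ]a, b[, so
    that no normalization is needed to approximate the indicator of the interval. *)
Definition bump a b k : R -> R :=
  fun x => flat 0 (k.+1%:R * (x - a)) * flat 0 (k.+1%:R * (b - x)).

Lemma bump_smooth a b k : smooth (bump a b k).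
Proof.
move=> n; rewrite /bump; apply: diffnM.
  have := diffn_affine (k.+1%:R) (- (k.+1%:R * a)) (diffn_flat n 0).
  by under eq_fun do rewrite -mulrN -mulrDr.
have := diffn_affine (- k.+1%:R) (k.+1%:R * b) (diffn_flat n 0).
by under eq_fun do rewrite addrC mulNr -mulrBr.
Qed.

Lemma bump_ge0 a b k x : 0 <= bump a b k x.
Proof. by rewrite mulr_ge0// flat_ge0. Qed.

Lemma bump_le1 a b k x : bump a b k x <= 1.
Proof.
by rewrite -[leRHS]mulr1 ler_pM ?flat_ge0// flat0_le1.
Qed.

Lemma bump_out a b k x : ~~ (a < x < b) -> bump a b k x = 0.
Proof.
rewrite negb_and -!leNgt /bump => /orP[xa|bx].
  by rewrite flat_le0 ?mul0r// pmulr_rle0 ?ltr0n// subr_le0.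
by rewrite [X in _ * X]flat_le0 ?mulr0// pmulr_rle0 ?ltr0n// subr_le0.
Qed.

Lemma bump_test a b k : test_function (bump a b k).
Proof.
apply: (@smooth_test _ a b); first exact: bump_smooth.
move=> x xab; apply: bump_out; apply: contra xab => /andP[ax xb].
by rewrite !ltW.
Qed.

Lemma bump_cvg a b x : bump a b n x @[n --> \oo] --> (\1_(`]a, b[) x : R).
Proof.
have [xab|xab] := boolP (a < x < b); last first.
  rewrite indicE memNset ?in_itv/=; last exact/negP.
  under eq_fun do rewrite bump_out//.
  exact: cvg_cst.
rewrite indicE mem_set /= ?in_itv//=; move/andP : xab => [ax xb].
have cvoo (c : R) : 0 < c -> n.+1%:R * c @[n --> \oo] --> +oo.
  move=> c0; have cM : r * c @[r --> +oo%R] --> +oo by apply: gt0_cvgMly.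
  apply: (cvg_comp (fun n => n.+1%:R : R) _ _ cM).
  by rewrite (cvg_shiftS (fun n => n%:R : R)); exact: cvgr_idn.
rewrite -[X in _ --> X](mulr1 1); apply: cvgM.
  by apply: flat0_cvg; apply: cvoo; rewrite subr_gt0.
by apply: flat0_cvg; apply: cvoo; rewrite subr_gt0.
Qed.

Lemma bump_norm_le1 a b k x : `|bump a b k x| <= 1.
Proof. by rewrite ger0_norm ?bump_ge0// bump_le1. Qed.

(** The bumps on ]a, b[ are bounded by 1 and tend to the indicator of ]a, b[, so the
    hypothesis passes to the limit by dominated convergence. *)
Lemma itv_integral0 w : locally_integrable setT w ->
  (forall theta, smooth theta -> test_function theta -> \int[mu]_x (w x * theta x) = 0) ->
  forall a b, \int[mu]_x (w x * \1_(`]a, b[) x) = 0.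
Proof.
move=> wl w0 a b; have [mw _ _] := wl.
have wL : L1 (fun x => `|w x * \1_(`[a, b]) x|).
  by apply: L1_norm; exact: locint_itv.
have bw n x : `|w x * bump a b n x| <= `|w x * \1_(`[a, b]) x|.
  rewrite normrM [leRHS]normrM ler_wpM2l// indicE.
  have [xab|xab] := boolP (a < x < b); last by rewrite bump_out// normr0.
  rewrite mem_set ?normr1 ?bump_norm_le1//= in_itv/=.
  by move/andP : xab => [/ltW -> /ltW ->].
have [_] := @I_dominated R (fun n x => w x * bump a b n x)
  (fun x => w x * \1_(`]a, b[) x) _ (fun n => measurable_funM mw
    (smooth_measurable (bump_smooth a b n)))
  (fun x => cvgM (cvg_cst (w x)) (@bump_cvg a b x)) bw wL.
under eq_fun do rewrite (w0 _ (bump_smooth a b _) (bump_test a b _)).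
by move=> /cvg_lim <- //; rewrite lim_cst.
Qed.

(** The primitive of w from -n vanishes identically, and by Lebesgue's differentiation
    theorem w is almost everywhere its derivative. *)
Lemma ae0_itv w : locally_integrable setT w ->
  (forall a b, \int[mu]_x (w x * \1_(`]a, b[) x) = 0) ->
  {ae mu, forall x, w x = 0}.
Proof.
move=> wl w0; have [mw _ wK] := wl.
have wL a b : mu.-integrable `[a, b] (EFin \o w).
  apply/integrableP; split.
    by apply/measurable_EFinP; exact: measurable_funS mw.
  by apply: wK => //; exact: segment_compact.
have wI a b : \int[mu]_(x in `[a, b]) w x = 0.
  have [ab|ab] := leP a b; last first.
    by rewrite set_itv_ge ?Rintegral_set0// bnd_simp -ltNge.
  rewrite -Rintegral_itv_obnd_cbnd; last first.
    by apply: integrableS (wL a b) => //; apply: subset_itvr; rewrite bnd_simp.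
  rewrite -Rintegral_itv_bndo_bndc; last first.
    by apply: integrableS (wL a b) => //; apply: subset_itv; rewrite bnd_simp.
  rewrite -[RHS](w0 a b) Rintegral_mkcond; apply: eq_Rintegral => x _.
  by rewrite patchE indicE; case: (_ \in _); rewrite ?mulr1 ?mulr0.
have H n : {ae mu, forall x, - n%:R < x -> w x = 0}.
  have := @FTC1 R w (BLeft (- n%:R)) (wL _) wl.
  apply: (@filterS _ _ (ae_filter_ringOfSetsType mu)) => x /= h nx.
  have [] := h; first by rewrite lte_fin.
  move=> _ <-.
  have -> : (fun y => \int[mu]_(t in [set` Interval (BLeft (- n%:R)) (BRight y)]) w t) = cst 0.
    by apply/funext => y; rewrite wI.
  by rewrite derive1_cst.
have := ae_foralln H; apply: (@filterS _ _ (ae_filter_ringOfSetsType mu)) => x hx.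
apply: (hx (Num.truncn `|x|).+1).
rewrite ltrNl (le_lt_trans (ler_norm _))// normrN. exact: Num.Theory.truncnS_gt.
Qed.

End Bumps.

(** * The lemma of du Bois-Reymond *)

Section DuBoisReymond.
Context {R : realType}.
Local Notation mu := (@lebesgue_measure R).
Implicit Types (f g w theta : R -> R) (a b x M : R) (n k : nat).

Lemma test_bounded theta : smooth theta -> test_function theta ->
  exists k : R, forall x, `|theta x| <= k.
Proof.
move=> st [_ [M tM]].
have [|k [_ kP]] := @compact_bounded _ _ (theta @` `[- M, M]).
  apply: continuous_compact; last exact: segment_compact.
  by apply: continuous_subspaceT; exact: smooth_continuous.
exists (`|k| + 1) => x; have [xM|/tM->] := leP `|x| M; last by rewrite normr0 addr_ge0.
apply: kP; first by rewrite (le_lt_trans (ler_norm k))// ltrDl.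
by exists x => //=; rewrite in_itv/= -ler_norml.
Qed.

Lemma locint_test w theta : locally_integrable setT w -> smooth theta ->
  test_function theta -> L1 (fun x => w x * theta x).
Proof.
move=> wl st tt; have [k kP] := test_bounded st tt; have [_ [M tM]] := tt.
apply: (@locint_bounded _ _ _ (- M) M k) => //; first exact: smooth_measurable.
by move=> x; rewrite -ler_norml -ltNge => /tM.
Qed.

(** The mean of S has to vanish for its antiderivative to have compact support. *)
Lemma smooth_antiderivative S : smooth S -> test_function S -> \int[mu]_x S x = 0 ->
  exists theta, [/\ smooth theta, test_function theta &
    forall x, is_derive x 1 theta (S x)].
Proof.
move=> sS tS IS0; have [_ [M SM]] := tS.
have SL : L1 S.
  by have := locint_test (locint_cst 1) sS tS; apply: eq_L1 => x; rewrite mul1r.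
pose theta (x : R) := \int[mu]_(t in [set` Interval -oo%O (BRight x)]) S t.
have dtheta x : is_derive x 1 theta (S x).
  have xx : x < x + 1 by rewrite ltrDl.
  have iS : mu.-integrable [set` Interval -oo%O (BRight (x + 1))] (EFin \o S).
    exact: integrableS SL.
  have [d1 d2] := @continuous_FTC1 R S -oo%O x (x + 1) xx iS (ltNyr _)
    (@smooth_continuous _ _ sS x).
  by apply: DeriveDef; rewrite -?derive1E.
have st : smooth theta by case=> [//|n]; exists S.
exists theta; split => //; apply: (@smooth_test _ theta (- M) M) => // x.
rewrite negb_and -!ltNge => /orP[xM|xM].
  transitivity (\int[mu]_(t in `]-oo, x]) (0 : R)); last first.
    by rewrite Rintegral_cst// mul0r.
  apply: eq_Rintegral => t; rewrite inE/= in_itv/= => tx; apply: SM.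
  by rewrite ltr_normr; apply/orP; right; rewrite ltrNr (le_lt_trans tx).
rewrite -[RHS]IS0 /theta Rintegral_mkcond; apply: eq_Rintegral => t _.
rewrite patchE; case: ifPn => //; rewrite notin_setE/= in_itv/= => /negP; rewrite -ltNge => xt.
by rewrite SM// ltr_normr (lt_trans xM xt).
Qed.

(** Fix one bump S0 with nonzero integral.  Every test function theta becomes the
    derivative of a test function after subtraction of a multiple k S0, so w integrates
    against theta exactly as the constant c = int w S0 / int S0 does. *)
Lemma du_bois_reymond w : locally_integrable setT w ->
  (forall theta S, smooth theta -> test_function theta -> smooth S -> test_function S ->
     (forall x, is_derive x 1 theta (S x)) -> \int[mu]_x (w x * S x) = 0) ->
  exists c, {ae mu, forall x, w x = c}.
Proof.
move=> wl w0.
have [n s0] : exists n, \int[mu]_x bump 0 1 n x != 0.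
  apply: contrapT => /forallNP h.
  have [||||_] := @I_dominated R (bump 0 1) (\1_(`]0, 1[)) (\1_(`[0, 1])).
  - by move=> n; apply: smooth_measurable; exact: bump_smooth.
  - by move=> x; exact: bump_cvg.
  - move=> n x; rewrite indicE; have [x01|x01] := boolP (0 < x < 1).
      rewrite mem_set ?bump_norm_le1//= in_itv/=.
      by move/andP : x01 => [/ltW -> /ltW ->].
    by rewrite bump_out// normr0.
  - by apply: eq_L1 (locint_itv 0 1 (locint_cst 1)) => x; rewrite mul1r.
  have h1 m : \int[mu]_x bump 0 1 m x = 0 :> R by apply/eqP/negP => /negP; exact: h.
  under eq_fun do rewrite h1.
  move=> /cvg_lim; rewrite lim_cst// => /(_ _) h0.
  have : \int[mu]_x (\1_(`]0, 1[) x) = 1 :> R.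
    have := @lebesgue_measure_itv R `]0, 1[.
    rewrite /= lte_fin ltr01 -EFinB subr0 => e.
    by rewrite /Rintegral integral_indic// setIT; exact: (congr1 fine e).
  by rewrite -h0// => /eqP; rewrite eq_sym oner_eq0.
pose S0 := bump 0 1 n : R -> R.
have sS0 : smooth S0 by exact: bump_smooth.
have tS0 : test_function S0 by exact: bump_test.
have lL theta := @locint_test _ theta (locint_cst 1).
have L1t theta : smooth theta -> test_function theta -> L1 theta.
  by move=> st tt; apply: eq_L1 (lL _ st tt) => x; rewrite mul1r.
pose c := (\int[mu]_x (w x * S0 x)) / \int[mu]_x S0 x.
exists c.
have wcl : locally_integrable setT (fun x => w x - c).
  by apply: locally_integrableB => //; exact: locint_cst.
suff h theta : smooth theta -> test_function theta -> \int[mu]_x ((w x - c) * theta x) = 0.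
  have := ae0_itv wcl (itv_integral0 wcl h).
  apply: (@filterS _ _ (ae_filter_ringOfSetsType mu)) => x /eqP.
  by rewrite subr_eq0 => /eqP.
move=> st tt; have tL := L1t _ st tt; have S0L := L1t _ sS0 tS0.
pose k := (\int[mu]_x theta x) / \int[mu]_x S0 x.
pose S := fun x => theta x + (- k) * S0 x.
have sS : smooth S.
  by move=> m; apply: diffnD => //; apply: diffnM => //; exact: diffn_cst.
have tS : test_function S.
  have [_ [M tM]] := tt; have [_ [M0 tM0]] := tS0.
  apply: (@smooth_test _ _ (- Num.max M M0) (Num.max M M0)) => // x.
  rewrite -ler_norml -ltNge gt_max => /andP[/tM Mx /tM0 M0x].
  by rewrite /S Mx M0x mulr0 addr0.
have IS : \int[mu]_x S x = 0.
  rewrite ID ?IZ//; last exact: L1Z.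
  by rewrite mulNr /k mulfVK// subrr.
have [Th [sTh tTh dTh]] := smooth_antiderivative sS tS IS.
have := w0 _ _ sTh tTh sS tS dTh.
have wt := locint_test wl st tt; have wS0 := locint_test wl sS0 tS0.
rewrite (@eq_I _ _ (fun x => w x * theta x + (- k) * (w x * S0 x))); last first.
  by move=> x; rewrite /S mulrDr mulrCA.
rewrite ID ?IZ//; last exact: L1Z.
move=> wk.
rewrite (@eq_I _ _ (fun x => w x * theta x + (- c) * theta x)); last first.
  by move=> x; rewrite mulrDl.
rewrite ID ?IZ//; last exact: L1Z.
rewrite -[RHS]wk; congr (_ + _); rewrite !mulNr; congr (- _).
rewrite /c /k mulrAC [RHS]mulrAC; congr (_ / _); exact: mulrC.
Qed.

End DuBoisReymond.

(** * Primitives of locally integrable functions *)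

Section Primitive.
Context {R : realType}.
Local Notation mu := (@lebesgue_measure R).
Implicit Types (f g w theta h : R -> R) (a b x s M : R) (n : nat).

(** [signed_indic x] is 1 on ]0, x] when x >= 0 and -1 on ]x, 0] when x < 0; integrating
    against it gives the oriented integral from 0 to x without a case distinction. *)
Definition signed_indic x s : R := (s <= x)%R%:R - (s <= 0)%R%:R.

Definition primitive g x : R := \int[mu]_s (g s * signed_indic x s).

Lemma signed_indic_norm x s : `|signed_indic x s| <= 1.
Proof.
by rewrite /signed_indic; case: (s <= x); case: (s <= 0);
  rewrite ?subrr ?subr0 ?sub0r ?normrN ?normr0 ?normr1.
Qed.

Lemma signed_indic_out x s M : `|x| <= M -> ~~ (- M <= s <= M) -> signed_indic x s = 0.
Proof.
rewrite ler_norml => /andP[Mx xM]; rewrite negb_and -!ltNge /signed_indic.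
have M0 : 0 <= M by lra.
move=> /orP[sM|Ms].
  rewrite (le_trans (ltW sM) Mx) (le_trans (ltW sM)) ?subrr//.
  by rewrite lerNl oppr0.
by rewrite !leNgt (le_lt_trans xM Ms) (le_lt_trans M0 Ms) subrr.
Qed.

Lemma measurable_leb d (T : measurableType d) (p q : T -> R) :
  measurable_fun setT p -> measurable_fun setT q ->
  measurable_fun setT (fun z => (p z <= q z)%R%:R : R).
Proof.
move=> mp mq.
have -> : (fun z => (p z <= q z)%R%:R : R) = (fun z => if p z <= q z then 1 else 0).
  by apply/funext => z; case: (p z <= q z).
by apply: measurable_fun_ifT => //; exact: measurable_fun_ler.
Qed.

Lemma measurable_signed_indic x : measurable_fun setT (signed_indic x).
Proof. by apply: measurable_funB; apply: measurable_leb. Qed.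

Lemma measurable_signed_indic2 :
  measurable_fun setT (fun z : R * R => signed_indic z.1 z.2).
Proof. by apply: measurable_funB; apply: measurable_leb. Qed.

Section Fubini.
Variables (g h : R -> R) (M k : R).
Hypotheses (gl : locally_integrable setT g) (mh : measurable_fun setT h).
Hypotheses (hk : forall x, `|h x| <= k) (hM : forall x, M < `|x| -> h x = 0).

Let G (z : R * R) : \bar R := (g z.2 * signed_indic z.1 z.2 * h z.1)%:E.

Let mG : measurable_fun setT G.
Proof.
have [mg _ _] := gl.
apply/measurable_EFinP; apply: measurable_funM.
  apply: measurable_funM; last exact: measurable_signed_indic2.
  exact: measurableT_comp.
exact: measurableT_comp.
Qed.

Let gML : L1 (fun s => g s * \1_(`[- M, M]) s).
Proof. exact: locint_itv. Qed.

Let k0 : 0 <= k. Proof. exact: le_trans (hk 0). Qed.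

Let GL1 x : L1 (fun s => g s * signed_indic x s).
Proof.
apply: (@locint_bounded _ _ _ (- `|x|) `|x| 1) => //.
- exact: measurable_signed_indic.
- exact: signed_indic_norm.
- by move=> s; exact: signed_indic_out.
Qed.

Let iG : (mu \x mu)%E.-integrable setT G.
Proof.
apply/integrable12ltyP => //.
pose c := \int[mu]_s `|g s * \1_(`[- M, M]) s|.
have bL : L1 (fun x => k * c * \1_(`[- M, M]) x).
  apply: L1Z; apply: eq_L1 (locint_itv (- M) M (locint_cst 1)) => x.
  by rewrite mul1r.
apply: le_lt_trans (L1_lty bL).
apply: ge0_le_integral => //.
- move=> x _; exact: integral_ge0.
- apply: (@measurable_fun_fubini_tonelli_F _ _ _ _ _ mu (abse \o G)) => //=.
  exact: measurableT_comp.
- by apply/measurable_EFinP; exact: L1_measurable.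
move=> x _; have [xM|xM] := leP `|x| M; last first.
  rewrite (eq_integral (cst 0%E)); last first.
    by move=> s _; rewrite /G hM// mulr0 /= normr0.
  by rewrite integral0 lee_fin mulr_ge0// mulr_ge0// /c Rintegral_ge0.
rewrite indicE mem_set ?mulr1/=; last by rewrite in_itv/= -ler_norml.
have gnL := L1_norm gML.
rewrite -(IZ k gnL) -(integral_EFinR (L1Z k gnL)).
apply: ge0_le_integral => //.
- have [mg _ _] := gl.
  have H : measurable_fun setT (fun s => g s * signed_indic x s * h x).
    apply: measurable_funM; last exact: measurable_cst.
    by apply: measurable_funM => //; exact: measurable_signed_indic.
  by apply/measurable_EFinP; exact: (measurableT_comp (@normr_measurable R setT) H).
- by apply/measurable_EFinP; apply: L1_measurable; exact: L1Z.
move=> s _ /=; rewrite lee_fin !normrM mulrC ler_pM// ler_wpM2l//.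
rewrite indicE; have [sM|sM] := boolP (- M <= s <= M).
  by rewrite mem_set/= ?in_itv//= normr1 signed_indic_norm.
by rewrite (signed_indic_out xM)// normr0.
Qed.

(** On the support of h the kernel [signed_indic x s] vanishes for |s| > M, so the double
    integrand is dominated by k |g(s)| on a square and Fubini's theorem applies. *)
Lemma primitive_fubini :
  L1 (fun x => primitive g x * h x) /\
  \int[mu]_x (primitive g x * h x) =
  \int[mu]_s (g s * \int[mu]_x (signed_indic x s * h x)).
Proof.
have hE x : (\int[mu]_s G (x, s) = (primitive g x * h x)%:E)%E.
  rewrite /G/= integral_EFinR.
    rewrite /primitive -RintegralZr//; exact: GL1.
  have := L1Z (h x) (GL1 x); apply: eq_L1 => s; exact: mulrC.
have L : L1 (fun x => primitive g x * h x).
  have := integrable_fubini_F iG; rewrite /fubini_F.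
  by under eq_fun do rewrite hE.
split => //.
have hs s : L1 (fun x => signed_indic x s * h x).
  apply: (@L1_bounded _ _ (- M) M k).
  - apply: measurable_funM => //.
    by apply: measurable_funB; apply: measurable_leb.
  - move=> x; rewrite normrM -[leRHS]mul1r ler_pM//; exact: signed_indic_norm.
  - by move=> x; rewrite -ler_norml -ltNge => /hM ->; rewrite mulr0.
have hE2 s : (\int[mu]_x G (x, s) = (g s * \int[mu]_x (signed_indic x s * h x))%:E)%E.
  rewrite -IZ// -integral_EFinR; last exact: L1Z.
  by apply: eq_integral => x _; rewrite /G/= mulrA.
have := Fubini iG.
under eq_integral do rewrite hE.
under [X in _ = X -> _]eq_integral do rewrite hE2.
by rewrite integral_EFinR// => /(congr1 fine).
Qed.

End Fubini.

Lemma tail_integral theta S s : smooth S -> test_function S -> test_function theta ->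
  (forall x, is_derive x 1 theta (S x)) ->
  \int[mu]_x ((s <= x)%R%:R * S x) = - theta s.
Proof.
move=> sS [_ [M SM]] [_ [N tN]] dt.
pose b := Num.max s (Num.max M N) + 1.
have sb : s < b by rewrite /b ltr_pwDr// le_max lexx.
have Mb x : b <= x -> M < `|x| /\ N < `|x|.
  move=> bx; rewrite !ltr_normr; split; apply/orP; left; apply: lt_le_trans bx;
  by rewrite /b ltr_pwDr// !le_max lexx ?orbT.
have ct : continuous theta.
  by move=> x; apply: differentiable_continuous; apply/derivable1_diffP; exact: ex_derive.
have := @continuous_FTC2 R S theta s b sb (continuous_subspaceT (smooth_continuous sS)).
have dLR : derivable_oo_LRcontinuous theta s b.
  split; first by move=> x _; exact: ex_derive.
  - exact/cvg_at_right_filter/ct.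
  - exact/cvg_at_left_filter/ct.
move=> /(_ dLR) H.
have {}H : (\int[mu]_(x in `[s, b]) (S x)%:E = (- theta s)%:E)%E.
  have tb : theta b = 0 by apply: tN; have [] := Mb b (lexx _).
  rewrite H; first by rewrite tb -EFinB sub0r.
  by move=> x _; rewrite derive1E; apply: derive_val.
transitivity (\int[mu]_(x in `[s, b]) S x); last by rewrite /Rintegral H.
rewrite [RHS]Rintegral_mkcond; apply: eq_Rintegral => x _; rewrite patchE.
case: ifPn; rewrite ?inE ?notin_setE/= in_itv/=; first by move=> /andP[-> _]; rewrite mul1r.
move/negP; rewrite negb_and => /orP[/negbTE ->|]; first by rewrite mul0r.
by rewrite -ltNge => /ltW/Mb[/SM -> _]; rewrite mulr0.
Qed.

(** Integrating S against [signed_indic x s] in x gives - theta s; the contribution of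
    the part independent of x is a multiple of int S = 0. *)
Lemma primitive_weak g theta S : locally_integrable setT g ->
  smooth theta -> test_function theta -> smooth S -> test_function S ->
  (forall x, is_derive x 1 theta (S x)) ->
  L1 (fun x => primitive g x * S x) /\
  \int[mu]_x (primitive g x * S x) = - \int[mu]_x (g x * theta x).
Proof.
move=> gl st tt sS tS dt; have [_ [M SM]] := tS.
have [k kP] := test_bounded sS tS.
have [L ->] := primitive_fubini gl (smooth_measurable sS) kP SM; split => //.
have leL a : L1 (fun x => (a <= x)%R%:R * S x).
  apply: (@L1_bounded _ _ (- M) M k).
  - apply: measurable_funM; last exact: smooth_measurable.
    exact: measurable_leb.
  - move=> x; rewrite normrM -[leRHS]mul1r ler_pM//.
    by case: (a <= x); rewrite ?normr0 ?normr1.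
  - by move=> x; rewrite -ler_norml -ltNge => /SM ->; rewrite mulr0.
have IS0 : \int[mu]_x S x = 0.
  have [_ [N tN]] := tt.
  (* a lies to the left of both supports, so the tail integral from a is all of int S *)
  pose a := - (Num.max `|M| `|N| + 1).
  have aE : `|a| = Num.max `|M| `|N| + 1 by rewrite normrN ger0_norm// addr_ge0// le_max normr_ge0.
  have aN : N < `|a| by rewrite aE ltr_pwDr// le_max ler_norm orbT.
  rewrite -[RHS]oppr0 -(tN _ aN) -(tail_integral a sS tS tt dt).
  apply: eq_I => x; have [ax|xa] := leP a x; first by rewrite mul1r.
  rewrite mul0r SM// ltr_normr; apply/orP; right; rewrite ltrNr.
  by rewrite (lt_le_trans xa)// lerN2 (le_trans (ler_norm M))// ler_wpDr// le_max lexx.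
have SL := eq_L1 (fun x => mul1r _) (locint_test (locint_cst 1) sS tS).
rewrite -mulN1r -IZ; last exact: locint_test.
apply: eq_I => s.
rewrite (@eq_I _ _ (fun x => (s <= x)%R%:R * S x - (s <= 0)%R%:R * S x)); last first.
  by move=> x; rewrite /signed_indic mulrBl.
rewrite IB ?IZ//; last exact: L1Z.
by rewrite (tail_integral s sS tS tt dt) IS0 mulr0 subr0 mulrN mulN1r.
Qed.

Lemma primitive_locint g : locally_integrable setT g ->
  locally_integrable setT (primitive g).
Proof.
move=> gl.
have cutL n : L1 (fun x => primitive g x * \1_(`[- n%:R, n%:R]) x).
  have [|||+ _] := @primitive_fubini g (\1_(`[- n%:R, n%:R])) n%:R 1 gl.
  - exact: measurable_indic.
  - by move=> x; rewrite indicE; case: (_ \in _); rewrite ?normr1 ?normr0.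
  - by move=> x nx; rewrite indicE memNset//= in_itv/= -ler_norml; apply/negP; rewrite -ltNge.
  by [].
have cutE x : primitive g x * \1_(`[- n%:R, n%:R]) x @[n --> \oo] --> primitive g x.
  apply: cvg_near_cst; near=> n.
  rewrite indicE mem_set ?mulr1//= in_itv/= -ler_norml.
  near: n; exact: nbhs_infty_ger.
have mp : measurable_fun setT (primitive g).
  apply: (@measurable_fun_cvg _ _ _ _ (fun n x => primitive g x * \1_(`[- n%:R, n%:R]) x)).
    by move=> n; exact: L1_measurable.
  by move=> x _.
split => [//||K _ cK]; first exact: openT.
have [M [_ MP]] := compact_bounded cK.
pose n := (Num.truncn `|M|).+1.
have nK x : K x -> - n%:R <= x <= n%:R.
  move=> Kx; rewrite -ler_norml; apply: MP => //.
  rewrite (le_lt_trans (ler_norm M))//; exact: Num.Theory.truncnS_gt.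
apply: le_lt_trans (L1_lty (L1_norm (cutL n))).
rewrite integral_mkcond; apply: ge0_le_integral => //.
- by move=> x _; rewrite patchE; case: ifP.
- apply/(measurable_restrictT _ _).1; first exact: compact_measurable.
  apply: measurable_funTS; apply/measurable_EFinP.
  exact: (measurableT_comp (@normr_measurable R setT) mp).
- by apply/measurable_EFinP; apply: L1_measurable; exact: L1_norm.
move=> x _; rewrite patchE; case: ifPn => [/set_mem/nK xn|_]; last by rewrite lee_fin.
by rewrite indicE mem_set ?mulr1//= in_itv/=.
Unshelve. all: by end_near. Qed.

Lemma primitiveB g a b : locally_integrable setT g -> a <= b ->
  primitive g b - primitive g a = \int[mu]_s (g s * (a < s <= b)%R%:R).
Proof.
move=> gl ab; have L x : L1 (fun s => g s * signed_indic x s).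
  apply: (@locint_bounded _ _ _ (- `|x|) `|x| 1) => //.
  - exact: measurable_signed_indic.
  - exact: signed_indic_norm.
  - by move=> s; exact: signed_indic_out.
rewrite -IB//; apply: eq_I => s; rewrite -mulrBr; congr (_ * _).
rewrite /signed_indic opprB addrA subrK ltNge.
have [sa|sa] := leP s a; first by rewrite (le_trans sa ab) subrr.
by rewrite subr0.
Qed.

Lemma primitive0 g : primitive g 0 = 0.
Proof.
rewrite /primitive (@eq_I _ _ (fun=> 0)) ?Rintegral_cst ?mul0r//.
by move=> s; rewrite /signed_indic subrr mulr0.
Qed.

(** f and the primitive of g have the same weak derivative, so their difference is
    constant by the lemma of du Bois-Reymond. *)
Lemma weak_primitive f g : locally_integrable setT f -> locally_integrable setT g ->
  (forall theta S, smooth theta -> test_function theta -> smooth S -> test_function S ->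
    (forall x, is_derive x 1 theta (S x)) ->
    \int[mu]_x (f x * S x) = - \int[mu]_x (g x * theta x)) ->
  exists c, {ae mu, forall x, f x = c + primitive g x}.
Proof.
move=> fl gl H; have pl := primitive_locint gl.
have [|c hc] := @du_bois_reymond R (fun x => f x - primitive g x) (locally_integrableB fl pl).
  move=> theta S st tt sS tS dt.
  have [pL pE] := primitive_weak gl st tt sS tS dt.
  rewrite (@eq_I _ _ (fun x => f x * S x - primitive g x * S x)); last first.
    by move=> x; rewrite mulrBl.
  rewrite IB//; last exact: locint_test.
  by rewrite pE (H theta S)// subrr.
exists c; move: hc; apply: (@filterS _ _ (ae_filter_ringOfSetsType mu)) => x /eqP.
by rewrite subr_eq => /eqP.
Qed.

End Primitive.

(** * The kink and the moments of sech^2 *)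

Section Kink.
Context {R : realType}.
Local Notation mu := (@lebesgue_measure R).
Implicit Types (a b x y s k : R) (n : nat).
Local Notation phi := (@phi R).

Definition sech2 x : R := 1 - phi x ^+ 2.

Lemma smooth_phi : smooth phi.
Proof. by move=> n; exact: diffn_phi. Qed.

Lemma smooth_sech2 : smooth sech2.
Proof.
move=> n; have -> : sech2 = (fun x => 1 + (-1) * (phi x * phi x)).
  by apply/funext => x; rewrite mulN1r -expr2.
apply: diffnD; first exact: diffn_cst.
by apply: diffnM; [exact: diffn_cst|apply: diffnM; exact: diffn_phi].
Qed.

Lemma cosh_gt0 x : 0 < expR x + expR (- x).
Proof. by rewrite addr_gt0// expR_gt0. Qed.

Lemma sech2E x : sech2 x = 4 / (expR x + expR (- x)) ^+ 2.
Proof.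
have e0 := lt0r_neq0 (cosh_gt0 x); rewrite /sech2 /Defs.phi.
have := expRxMexpNx_1 x; set a := expR x in e0 *; set b := expR _ in e0 * => ab.
apply: (mulIf (expf_neq0 2 e0)); rewrite mulfVK ?expf_neq0//.
rewrite mulrBl expr_div_n mulfVK ?expf_neq0//.
transitivity (4 * (a * b)); [ring|by rewrite ab mulr1].
Qed.

Lemma sech2_gt0 x : 0 < sech2 x.
Proof. by rewrite sech2E divr_gt0// exprn_gt0// cosh_gt0. Qed.

Lemma phi2_lt1 x : phi x ^+ 2 < 1.
Proof. by rewrite -subr_gt0 sech2_gt0. Qed.

Lemma phi_itv x : -1 < phi x < 1.
Proof. by have := phi2_lt1 x; set y := phi x => y1; apply/andP; split; nra. Qed.

Lemma phiN x : phi (- x) = - phi x.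
Proof. by rewrite /Defs.phi opprK -mulNr opprB (addrC (expR x)). Qed.

Lemma phi0 : phi 0 = 0.
Proof. by rewrite /Defs.phi oppr0 subrr mul0r. Qed.

Lemma sech2_le1 x : sech2 x <= 1.
Proof. by rewrite /sech2 gerBl sqr_ge0. Qed.

Lemma phi_cvgy : phi x @[x --> +oo] --> (1 : R).
Proof.
have h x : 0 <= x -> 1 - 2 * expR (- x) <= phi x.
  move=> x0; have e0 := cosh_gt0 x; rewrite /Defs.phi ler_pdivlMr//.
  have e1 : expR (- x) <= 1 by rewrite expR_le1 oppr_le0.
  have := expRxMexpNx_1 x; have := expR_gt0 (- x).
  set a := expR x; set b := expR _ in e1 *; nra.
apply: (@squeeze_cvgr _ _ _ _ (fun x => 1 - 2 * expR (- x)) (cst 1)).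
- near=> y; have y0 : 0 <= y by near: y; exact: nbhs_pinfty_ge.
  by rewrite h//=; have /andP[_ /ltW] := phi_itv y.
- rewrite -[X in _ --> X]subr0 -[X in _ - X](mulr0 2).
  apply: cvgB; first exact: cvg_cst.
  by apply: cvgM; [exact: cvg_cst|exact: cvgr_expR].
- exact: cvg_cst.
Unshelve. all: by end_near. Qed.

(** The point where tanh is 1/3. *)
Definition kink_node : R := ln 2 / 2.

Lemma phi_node : phi kink_node = 3^-1.
Proof.
have e2 : expR kink_node ^+ 2 = 2 :> R.
  by rewrite -expRM_natl /kink_node mulrC mulfVK// lnK// posrE.
have e0 := expR_gt0 kink_node; rewrite /Defs.phi expRN; set a := expR kink_node in e2 e0 *.
have -> : (a - a^-1) / (a + a^-1) = (a ^+ 2 - 1) / (a ^+ 2 + 1).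
  by field; rewrite e2 (gt_eqF e0) andbT; apply: lt0r_neq0; lra.
by rewrite e2; field.
Qed.

Lemma node_gt0 : 0 < kink_node.
Proof. by rewrite divr_gt0// ln_gt0// ltr1n. Qed.


Lemma L1_sech2 : L1 sech2.
Proof.
have cs : continuous sech2 := smooth_continuous smooth_sech2.
apply: L1_ge0 => [|x|]; first exact: continuous_measurable_fun.
  exact/ltW/sech2_gt0.
rewrite ge0_symfun_integralT//; last 2 first.
- by move=> x; exact/ltW/sech2_gt0.
- by move=> x; rewrite /= /sech2 phiN sqrrN.
have -> : [set x : R | 0 <= x]%R = `[0, +oo[%classic.
  by apply/seteqP; split => x /=; rewrite in_itv/= andbT.
rewrite (@ge0_continuous_FTC2y _ _ phi 0 1).
- by rewrite phi0 -EFinB -EFinM ltry.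
- by move=> x _; exact/ltW/sech2_gt0.
- exact: continuous_subspaceT.
- exact: phi_cvgy.
- by move=> x _; apply: ex_derive; exact: is_derive_phi.
- exact/cvg_at_right_filter/smooth_continuous/smooth_phi.
- by move=> x _; rewrite derive1E; apply: derive_val; exact: is_derive_phi.
Qed.

Lemma I_FTC (F f : R -> R) a b : (forall x, is_derive x 1 F (f x)) -> continuous f ->
  a <= b -> \int[mu]_x (f x * (a <= x <= b)%R%:R) = F b - F a.
Proof.
move=> dF cf; rewrite le_eqVlt => /predU1P[->|ab].
  rewrite subrr -[RHS](Rintegral_set1 f b) [RHS]Rintegral_mkcond.
  apply: eq_Rintegral => x _; rewrite patchE -eq_le eq_sym.
  have [->|xb] := eqVneq x b; first by rewrite mem_set// mulr1.
  by rewrite memNset ?mulr0//=; apply/eqP.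
have cF : continuous F.
  by move=> x; apply: differentiable_continuous; apply/derivable1_diffP; exact: ex_derive.
have dLR : derivable_oo_LRcontinuous F a b.
  split; first by move=> x _; exact: ex_derive.
  - exact/cvg_at_right_filter/cF.
  - exact/cvg_at_left_filter/cF.
have H : (\int[mu]_(x in `[a, b]) (f x)%:E = (F b - F a)%:E)%E.
  rewrite (continuous_FTC2 ab (continuous_subspaceT cf) dLR)//.
  by move=> x _; rewrite derive1E; apply: derive_val.
transitivity (\int[mu]_(x in `[a, b]) f x); last by rewrite /Rintegral H.
rewrite [RHS]Rintegral_mkcond; apply: eq_Rintegral => x _; rewrite patchE.
by rewrite -[x \in _]/(x \in [set` `[a, b]]) mem_setE in_itv/=; case: ifP; rewrite ?mulr1 ?mulr0.
Qed.

Lemma locint_continuous (f : R -> R) : continuous f -> locally_integrable setT f.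
Proof.
move=> cf; split; [exact: continuous_measurable_fun|exact: openT|move=> K _ cK].
have : mu.-integrable K (EFin \o f).
  by apply: continuous_compact_integrable => //; exact: continuous_subspaceT.
by move=> /integrableP[].
Qed.

Lemma locint_sech2 : locally_integrable setT sech2.
Proof. exact/locint_continuous/smooth_continuous/smooth_sech2. Qed.

Lemma measurable_cc a b : measurable_fun setT (fun x : R => (a <= x <= b)%R%:R : R).
Proof.
have -> : (fun x : R => (a <= x <= b)%R%:R : R) = (fun x => (a <= x)%R%:R * (x <= b)%R%:R).
  by apply/funext => x; case: (a <= x); rewrite ?mul0r ?mul1r.
by apply: measurable_funM; apply: measurable_leb.
Qed.

Lemma measurable_oc a b : measurable_fun setT (fun x : R => (a < x <= b)%R%:R : R).
Proof.
have -> : (fun x : R => (a < x <= b)%R%:R : R) = (fun x => (1 - (x <= a)%R%:R) * (x <= b)%R%:R).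
  by apply/funext => x; rewrite ltNge; case: (x <= a); rewrite ?subrr ?mul0r ?subr0 ?mul1r.
apply: measurable_funM; last exact: measurable_leb.
by apply: measurable_funB => //; exact: measurable_leb.
Qed.

Lemma L1_cc (f : R -> R) a b : locally_integrable setT f ->
  L1 (fun x => f x * (a <= x <= b)%R%:R).
Proof.
move=> fl; apply: (@locint_bounded _ _ _ a b 1) => //; first exact: measurable_cc.
- by move=> x; case: (_ <= _ <= _); rewrite ?normr1 ?normr0.
- by move=> x /negbTE ->.
Qed.

(** The left endpoint is removed as the difference of two closed intervals, one of them
    degenerate. *)
Lemma I_FTC_oc (F f : R -> R) a b : (forall x, is_derive x 1 F (f x)) -> continuous f ->
  a <= b -> \int[mu]_x (f x * (a < x <= b)%R%:R) = F b - F a.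
Proof.
move=> dF cf ab; have fl := locint_continuous cf.
rewrite -[RHS]subr0 -[X in _ - X](subrr (F a)) -(I_FTC dF cf ab) -(I_FTC dF cf (lexx a)).
rewrite -IB; [|exact: L1_cc..].
apply: eq_I => x; rewrite -mulrBr; congr (_ * _); rewrite -eq_le.
have [xa|xa] := eqVneq a x; first by rewrite -xa ltxx lexx ab subrr.
by rewrite lt_neqAle xa subr0.
Qed.

Lemma primitive_sech2 x : primitive sech2 x = phi x.
Proof.
have cs : continuous sech2 := smooth_continuous smooth_sech2.
have [x0|/ltW x0] := leP 0 x.
  have := primitiveB locint_sech2 x0.
  by rewrite (I_FTC_oc is_derive_phi cs x0) primitive0 phi0 !subr0.
have := primitiveB locint_sech2 x0.
by rewrite (I_FTC_oc is_derive_phi cs x0) primitive0 phi0 !sub0r => /oppr_inj.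
Qed.

(** Since sech^2 dx = d(tanh x), a moment of sech^2 against p(tanh x) is an integral of p
    over a subinterval of ]-1, 1[. *)
Section Moments.
Variables (P p : R -> R) (k : R).
Hypotheses (dP : forall y, is_derive y 1 P (p y)) (cp : continuous p).
Hypothesis pk : forall y, -1 < y < 1 -> `|p y| <= k.

Let f x := sech2 x * p (phi x).

Let cphi : continuous phi := smooth_continuous smooth_phi.

Let cf : continuous f.
Proof.
move=> x; apply: cvgM; first exact: (smooth_continuous smooth_sech2).
by apply: continuous_comp; [exact: cphi|exact: cp].
Qed.

Let dF x : is_derive x 1 (fun x => P (phi x)) (f x).
Proof.
have := @is_derive_compr _ P phi x _ _ (dP (phi x)) (is_derive_phi x).
by rewrite /f mulrC.
Qed.

Lemma L1_moment : L1 f.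
Proof.
apply: L1_dom (L1Z k L1_sech2) => [|x]; first exact: continuous_measurable_fun.
have s0 := ltW (sech2_gt0 x).
by rewrite /f normrM mulrC (ger0_norm s0) ler_wpM2r//; apply: pk; exact: phi_itv.
Qed.

Let cP : continuous P.
Proof.
by move=> x; apply: differentiable_continuous; apply/derivable1_diffP; exact: ex_derive.
Qed.

Lemma tail_moment s : \int[mu]_x (f x * (s <= x)%R%:R) = P 1 - P (phi s).
Proof.
have mf : measurable_fun setT f by exact: continuous_measurable_fun.
have [|||_ H] := @I_dominated R (fun n x => f x * (s <= x <= n%:R)%R%:R)
    (fun x => f x * (s <= x)%R%:R) _ _ _ _ (L1_norm L1_moment).
- by move=> n; apply: measurable_funM => //; exact: measurable_cc.
- move=> x; apply: cvg_near_cst; near=> n.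
  have -> : x <= n%:R by near: n; exact: nbhs_infty_ger.
  by rewrite andbT.
- move=> n x; rewrite normrM -[leRHS]mulr1 ler_wpM2l//.
  by case: (_ <= _ <= _); rewrite ?normr1 ?normr0.
have cvPn : P (phi n%:R) - P (phi s) @[n --> \oo] --> P 1 - P (phi s).
  apply: cvgB; last exact: cvg_cst.
  exact: (cvg_comp _ _ (cvg_comp _ _ cvgr_idn phi_cvgy) (@cP 1)).
apply: (cvg_unique _ H) => //.
apply: cvg_trans cvPn; apply: near_eq_cvg; near=> n.
rewrite (I_FTC dF cf)//.
by near: n; exact: nbhs_infty_ger.
Unshelve. all: by end_near. Qed.

Lemma moment : \int[mu]_x f x = P 1 - P (-1).
Proof.
have mf : measurable_fun setT f by exact: continuous_measurable_fun.
have [|||_ H] := @I_dominated R (fun n x => f x * (- n%:R <= x)%R%:R) f _ _ _ _ (L1_norm L1_moment).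
- by move=> n; apply: measurable_funM => //; exact: measurable_leb.
- move=> x; apply: cvg_near_cst; near=> n.
  have -> : - n%:R <= x by rewrite lerNl; near: n; exact: nbhs_infty_ger.
  by rewrite mulr1.
- move=> n x; rewrite normrM -[leRHS]mulr1 ler_wpM2l//.
  by case: (_ <= x); rewrite ?normr1 ?normr0.
apply: (cvg_unique _ H) => //.
have cvPn : P 1 - P (- phi n%:R) @[n --> \oo] --> P 1 - P (-1).
  apply: cvgB; first exact: cvg_cst.
  exact: (cvg_comp _ _ (cvgN (cvg_comp _ _ cvgr_idn phi_cvgy)) (@cP (-1))).
apply: cvg_trans cvPn; apply: near_eq_cvg; apply: nearW => n.
by rewrite tail_moment phiN.
Unshelve. all: by end_near. Qed.

End Moments.

End Kink.

(** * A Hardy inequality with two nodes *)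

Section Hardy.
Context {R : realType}.
Local Notation mu := (@lebesgue_measure R).
Implicit Types (a b x y s k : R) (f g w : R -> R).
Local Notation phi := (@phi R).
Local Notation x0 := (@kink_node R).
Local Notation sech2 := (@sech2 R).

Lemma locint_dom f w : measurable_fun setT f -> (forall x, `|f x| <= w x) ->
  locally_integrable setT w -> locally_integrable setT f.
Proof.
move=> mf fw [mw _ wK]; split => [//||K KT cK]; first exact: openT.
apply: le_lt_trans (wK K KT cK); apply: ge0_le_integral => //.
- exact: compact_measurable.
- apply: measurable_funTS; apply/measurable_EFinP.
  exact: (measurableT_comp (@normr_measurable R setT) mf).
- apply: measurable_funTS; apply/measurable_EFinP.
  exact: (measurableT_comp (@normr_measurable R setT) mw).
- by move=> x _; rewrite lee_fin (le_trans (fw x))// ler_norm.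
Qed.

Lemma locint_L1 f : L1 f -> locally_integrable setT f.
Proof. by move=> fL; apply: (@open_integrable_locally _ setT f openT). Qed.

Lemma norm_le_sqr x : `|x| <= 1 + x ^+ 2.
Proof. by rewrite -real_normK ?num_real//; have := normr_ge0 x; set y := `|x|; nra. Qed.

Lemma locint_L2 f : measurable_fun setT f -> L1 (fun x => f x ^+ 2) ->
  locally_integrable setT f.
Proof.
move=> mf fL; apply: (@locint_dom f (fun x => 1 + f x ^+ 2)) => //.
  by move=> x; exact: norm_le_sqr.
by apply: locally_integrableD; [exact: locint_cst|exact: locint_L1].
Qed.

(** The discriminant form of the Cauchy-Schwarz inequality.  The minimizing value is
    t = A / B; when B = 0 the hypothesis is affine in t and forces A = 0. *)
Lemma sqr_le_mul (A B C : R) : 0 <= B ->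
  (forall t, 2 * t * A <= t ^+ 2 * B + C) -> A ^+ 2 <= B * C.
Proof.
move=> B0 H; move: B0; rewrite le_eqVlt => /predU1P[B0|B0].
  rewrite -B0 mul0r; have [->|A0] := eqVneq A 0; first by rewrite expr0n.
  have := H ((C + 1) / (2 * A)); rewrite -B0 mulr0 add0r.
  have -> : 2 * ((C + 1) / (2 * A)) * A = C + 1 by field.
  lra.
have := H (A / B); rewrite -(ler_pM2l B0).
have -> : B * (2 * (A / B) * A) = 2 * A ^+ 2 by field; rewrite gt_eqF.
have -> : B * ((A / B) ^+ 2 * B + C) = A ^+ 2 + B * C by field; rewrite gt_eqF.
lra.
Qed.

(** The node, among the two points where tanh is 1/3 or -1/3, from which the point x is
    reached.  The middle interval is reached from its left end only: the constant 3 of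
    the inequality below leaves room for this. *)
Definition node x : R := if x < x0 then - x0 else x0.

(** The indicator of the interval between x and its node, as a function of s; the second
    term is nonzero only to the left of both nodes. *)
Definition between x s : R := (node x < s <= x)%R%:R + (x < s <= - x0)%R%:R.

Lemma betweenE1 x s : x < - x0 -> between x s = (x < s <= - x0)%R%:R.
Proof.
move=> xx; have x00 := @node_gt0 R; rewrite /between /node.
have -> : x < x0 by lra.
have -> : (- x0 < s <= x) = false; last by rewrite add0r.
by apply/negP => /andP[h1 h2]; move: (lt_le_trans h1 h2); rewrite ltNge (ltW xx).
Qed.

Lemma betweenE2 x s : - x0 <= x -> between x s = (node x < s <= x)%R%:R.
Proof.
move=> xx; rewrite /between.
have -> : (x < s <= - x0) = false; last by rewrite addr0.
by apply/negP => /andP[h1 h2]; move: (lt_le_trans h1 h2); rewrite ltNge xx.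
Qed.

Lemma node_le x : - x0 <= x -> node x <= x.
Proof. by rewrite /node; case: ltP. Qed.

Lemma between_ge0 x s : 0 <= between x s.
Proof. by rewrite addr_ge0. Qed.

Lemma between_le1 x s : between x s <= 1.
Proof.
have [xx|xx] := ltP x (- x0).
  by rewrite betweenE1//; case: (_ < _ <= _).
by rewrite betweenE2//; case: (_ < _ <= _).
Qed.

Lemma between_out x s : ~~ (- (`|x| + x0) <= s <= `|x| + x0) -> between x s = 0.
Proof.
have x00 := @node_gt0 R; have xn := ler_norm x; have xn' := ler_norm (- x).
rewrite normrN in xn'.
move=> H; have [xx|xx] := ltP x (- x0).
  rewrite betweenE1//; case: (boolP (x < s <= - x0)) => // /andP[h1 h2].
  by move/negP: H; case; apply/andP; split; lra.
rewrite betweenE2//; case: (boolP (node x < s <= x)) => // /andP[h1 h2].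
move/negP: H; case; apply/andP; split; last lra.
by move: h1; rewrite /node; case: ifP => _; lra.
Qed.

Lemma measurable_between x : measurable_fun setT (between x).
Proof. by apply: measurable_funD; exact: measurable_oc. Qed.

Lemma measurable_oc2 d (T : measurableType d) (p q r : T -> R) :
  measurable_fun setT p -> measurable_fun setT q -> measurable_fun setT r ->
  measurable_fun setT (fun z => (p z < q z <= r z)%R%:R : R).
Proof.
move=> mp mq mr.
have -> : (fun z => (p z < q z <= r z)%R%:R : R) =
    (fun z => (1 - (q z <= p z)%R%:R) * (q z <= r z)%R%:R).
  by apply/funext => z; rewrite ltNge; case: (q z <= p z);
    rewrite ?subrr ?mul0r ?subr0 ?mul1r.
apply: measurable_funM; last exact: measurable_leb.
by apply: measurable_funB => //; exact: measurable_leb.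
Qed.

Lemma measurable_node : measurable_fun setT node.
Proof. by apply: measurable_fun_ifT => //; exact: measurable_fun_ltr. Qed.

Lemma measurable_between2 : measurable_fun setT (fun z : R * R => between z.1 z.2).
Proof.
apply: measurable_funD; apply: measurable_oc2 => //.
exact: (measurableT_comp measurable_node).
Qed.

Lemma I_between g x : locally_integrable setT g ->
  \int[mu]_s (g s * between x s) =
  if x < - x0 then primitive g (- x0) - primitive g x
  else primitive g x - primitive g (node x).
Proof.
move=> gl; case: ltP => xx.
  by rewrite (primitiveB gl (ltW xx)); apply: eq_I => s; rewrite betweenE1.
by rewrite (primitiveB gl (node_le xx)); apply: eq_I => s; rewrite betweenE2.
Qed.

Lemma L1_between g x : locally_integrable setT g -> L1 (fun s => g s * between x s).
Proof.
move=> gl; apply: (@locint_bounded _ _ _ (- (`|x| + x0)) (`|x| + x0) 1) => //.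
- exact: measurable_between.
- by move=> s; rewrite ger0_norm ?between_ge0 ?between_le1.
- by move=> s; exact: between_out.
Qed.

(** The mass that sech^2 gives to that interval, that is |tanh x - tanh (node x)|. *)
Definition weight x : R := \int[mu]_s (sech2 s * between x s).

Lemma weightE x : weight x = if x < - x0 then - 3^-1 - phi x
  else if x < x0 then phi x + 3^-1 else phi x - 3^-1.
Proof.
rewrite /weight I_between; last exact: locint_sech2.
rewrite !primitive_sech2 phiN phi_node; case: (ltP x (- x0)) => // _.
by rewrite /node; case: (ltP x x0) => _; rewrite ?phiN phi_node ?opprK.
Qed.

Lemma weight_ge0 x : 0 <= weight x.
Proof.
by rewrite /weight Rintegral_ge0// => s _; rewrite mulr_ge0 ?between_ge0// ltW// sech2_gt0.
Qed.

Lemma measurable_phi : measurable_fun setT phi.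
Proof. apply: smooth_measurable; exact: smooth_phi. Qed.

Lemma measurable_sech2 : measurable_fun setT sech2.
Proof. apply: smooth_measurable; exact: smooth_sech2. Qed.

Lemma measurable_weight : measurable_fun setT weight.
Proof.
have -> : weight = (fun x => if x < - x0 then - 3^-1 - phi x
  else if x < x0 then phi x + 3^-1 else phi x - 3^-1).
  by apply/funext => x; rewrite weightE.
have mp := measurable_phi.
apply: measurable_fun_ifT; first exact: measurable_fun_ltr.
  exact: measurable_funB.
apply: measurable_fun_ifT; first exact: measurable_fun_ltr.
  exact: measurable_funD.
exact: measurable_funB.
Qed.

Lemma continuous_sech2V : continuous (fun x => (sech2 x)^-1).
Proof.
move=> x; apply: cvgV; first by rewrite gt_eqF// sech2_gt0.
exact: (smooth_continuous smooth_sech2).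
Qed.

(** Integrate first in x.  With t = tanh s the integral is that of |y - c| over an
    interval of y, where c is the value of tanh at the node; it differs from
    (1 - t^2) / 3 by (1 - t)^2 / 6 to the right of both nodes and by (1 + t)^2 / 6
    otherwise.  The nodes 1/3 and -1/3 are chosen for this. *)
Lemma transposed_weight s :
  L1 (fun x => sech2 x * weight x * between x s) /\
  \int[mu]_x (sech2 x * weight x * between x s) <= sech2 s / 3.
Proof.
have x00 := @node_gt0 R.
have dP c y : is_derive y 1 (fun z : R => z ^+ 2 / 2 + c * z) (y + c).
  have d1 := is_deriveMr (is_deriveXr 2 (is_derive_id y 1)) (is_derive_cst (2^-1 : R) y 1).
  have d2 := is_deriveMr (is_derive_cst c y 1) (is_derive_id y 1).
  by apply: (is_derive_eq (is_deriveDr d1 d2)); rewrite /=; field.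
have cp c : continuous (fun z : R => z + c).
  by move=> z; apply: cvgD; [exact: cvg_id|exact: cvg_cst].
have pk (c y : R) : -1 < y < 1 -> `|y + c| <= 1 + `|c|.
  move=> /andP[y1 y2]; rewrite (le_trans (ler_normD _ _))// lerD2r.
  by rewrite ler_norml !ltW.
have mL c := L1_moment (@cp c) (@pk c).
have tailL c a : L1 (fun x => sech2 x * (phi x + c) * (a <= x)%R%:R).
  apply: L1_dom (L1_norm (mL c)) => [|x].
    apply: measurable_funM; last exact: measurable_leb.
    exact: L1_measurable.
  rewrite normrM -[leRHS]mulr1 ler_wpM2l//.
  by case: (_ <= x); rewrite ?normr1 ?normr0.
have tailI c a := tail_moment (dP c) (@cp c) (@pk c) a.
have totI c := moment (dP c) (@cp c) (@pk c).
have [sx|xs] := ltP x0 s.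
  have E x : sech2 x * (phi x + - 3^-1) * (s <= x)%R%:R =
             sech2 x * weight x * between x s.
    have [xx|xx] := ltP x (- x0).
      have -> : (s <= x) = false by apply/negbTE; rewrite -ltNge; lra.
      rewrite betweenE1//.
      have -> : (s <= - x0) = false by apply/negbTE; rewrite -ltNge; lra.
      by rewrite andbF !mulr0.
    rewrite betweenE2// weightE ltNge xx/= /node; case: ltP => xx2.
      have -> : (s <= x) = false by apply/negbTE; rewrite -ltNge; lra.
      by rewrite andbF !mulr0.
    by rewrite sx.
  split; first exact: eq_L1 (tailL _ _).
  rewrite -(eq_I E) tailI /sech2.
  set t := phi s; have -> : 1 ^+ 2 / 2 + - 3^-1 * 1 - (t ^+ 2 / 2 + - 3^-1 * t) =
    (1 - t ^+ 2) / 3 - (1 - t) ^+ 2 / 6 by field.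
  by rewrite lerBlDr lerDl divr_ge0// sqr_ge0.
have bound (t : R) : 6^-1 - t ^+ 2 / 2 - t / 3 <= (1 - t ^+ 2) / 3.
  have -> : 6^-1 - t ^+ 2 / 2 - t / 3 = (1 - t ^+ 2) / 3 - (1 + t) ^+ 2 / 6 by field.
  by rewrite lerBlDr lerDl divr_ge0// sqr_ge0.
have [sx|sx] := ltP (- x0) s.
  have E x : sech2 x * (phi x + 3^-1) * (s <= x)%R%:R -
             sech2 x * (phi x + 3^-1) * (x0 <= x)%R%:R =
             sech2 x * weight x * between x s.
    have [xx|xx] := ltP x (- x0).
      rewrite betweenE1// (leNgt s (- x0)) sx andbF !leNgt.
      have -> : x < s by lra.
      have -> : x < x0 by lra.
      by rewrite !mulr0 subrr.
    rewrite betweenE2// weightE ltNge xx/= /node; case: ltP => xx2.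
      by rewrite sx mulr0 subr0.
    have -> : s <= x by lra.
    by rewrite ltNge xs subrr !mulr0.
  split; first exact: eq_L1 (L1B (tailL _ _) (tailL _ _)).
  rewrite -(eq_I E) IB// !tailI phi_node /sech2.
  apply: le_trans (bound (phi s)); rewrite le_eqVlt; apply/orP; left; apply/eqP.
  by field.
have E x : (-1) * (sech2 x * (phi x + 3^-1) - sech2 x * (phi x + 3^-1) * (s <= x)%R%:R) =
           sech2 x * weight x * between x s.
  have [xx|xx] := ltP x (- x0).
    rewrite betweenE1// weightE xx sx andbT ltNge.
    by case: (s <= x) => /=; ring.
  have -> : s <= x by lra.
  rewrite betweenE2//.
  have -> : (node x < s) = false.
    by rewrite /node; case: ifP => _; apply/negbTE; rewrite -leNgt; lra.
  by rewrite /=; ring.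
split; first exact: eq_L1 (L1Z _ (L1B (mL _) (tailL _ _))).
rewrite -(eq_I E) IZ ?IB//; last exact: L1B.
rewrite tailI totI /sech2.
apply: le_trans (bound (phi s)); rewrite le_eqVlt; apply/orP; left; apply/eqP.
by field.
Qed.

Section Inequality.
Variable g : R -> R.
Hypotheses (mg : measurable_fun setT g) (gL : L1 (fun x => g x ^+ 2)).

Let gl : locally_integrable setT g := locint_L2 mg gL.

Let q s := g s ^+ 2 / sech2 s.

Let mq : measurable_fun setT q.
Proof.
apply: measurable_funM; first exact: measurable_funX.
exact: (continuous_measurable_fun continuous_sech2V).
Qed.

Let q_ge0 s : 0 <= q s.
Proof. by rewrite divr_ge0 ?sqr_ge0// ltW// sech2_gt0. Qed.

Let ql : locally_integrable setT q.
Proof.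
split=> [//||K _ cK]; first exact: openT.
have [k [_ kP]] : bounded_set ((fun x => (sech2 x)^-1) @` K).
  apply: compact_bounded; apply: continuous_compact => //.
  exact/continuous_subspaceT/continuous_sech2V.
have qk x : K x -> q x <= (`|k| + 1) * g x ^+ 2.
  move=> Kx; rewrite /q mulrC ler_wpM2r ?sqr_ge0//.
  apply: le_trans (ler_norm _) _; apply: kP; last by exists x.
  by rewrite (le_lt_trans (ler_norm k))// ltrDl.
have kgL := L1Z (`|k| + 1) gL.
apply: le_lt_trans (L1_lty kgL).
rewrite integral_mkcond; apply: ge0_le_integral => //.
- by move=> x _; rewrite patchE; case: ifP.
- apply/(measurable_restrictT _ _).1; first exact: compact_measurable.
  apply: measurable_funTS; apply/measurable_EFinP.
  exact: (measurableT_comp (@normr_measurable R setT) mq).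
- by apply/measurable_EFinP; exact: L1_measurable.
move=> x _; rewrite patchE; case: ifPn => [/set_mem/qk|_].
  by rewrite lee_fin (ger0_norm (q_ge0 x)).
by rewrite lee_fin mulr_ge0// ?sqr_ge0// addr_ge0.
Qed.

Lemma between_cauchy_schwarz x :
  (\int[mu]_s (g s * between x s)) ^+ 2 <= weight x * \int[mu]_s (q s * between x s).
Proof.
apply: sqr_le_mul; first exact: weight_ge0.
move=> t; have gb := L1_between x gl; have sb := L1_between x (@locint_sech2 R).
have qb := L1_between x ql.
rewrite /weight -!IZ// -ID//; last exact: L1Z.
apply: I_le => [||s]; [exact: L1Z|by apply: L1D => //; exact: L1Z|].
rewrite !mulrA -mulrDl ler_wpM2r ?between_ge0// /q.
have s0 := @sech2_gt0 R s; set c := sech2 s in s0 *; rewrite -subr_ge0.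
have -> : t ^+ 2 * c + g s ^+ 2 / c - 2 * t * g s = (t * c - g s) ^+ 2 / c.
  by field; rewrite gt_eqF.
by rewrite divr_ge0 ?sqr_ge0// ltW.
Qed.

(** Cauchy-Schwarz bounds the square of the primitive by [weight] times an integral of
    g^2 / sech^2 over [between]; exchanging the integrals, [transposed_weight] turns the
    factor 1 / sech^2 into 1/3. *)
Lemma hardy : primitive g (- x0) = primitive g x0 ->
  L1 (fun x => sech2 x * (primitive g x - primitive g x0) ^+ 2) /\
  3 * \int[mu]_x (sech2 x * (primitive g x - primitive g x0) ^+ 2) <=
  \int[mu]_x g x ^+ 2.
Proof.
move=> gx0; pose K x := primitive g x - primitive g x0.
pose C x := \int[mu]_s (q s * between x s).
have KE x : K x ^+ 2 = (\int[mu]_s (g s * between x s)) ^+ 2.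
  rewrite I_between// /K; case: ifP => _; first by rewrite gx0 -sqrrN opprB.
  by rewrite /node; case: ifP => _; rewrite ?gx0.
have K_le x : sech2 x * K x ^+ 2 <= sech2 x * weight x * C x.
  rewrite -mulrA ler_wpM2l ?(ltW (sech2_gt0 x))// KE.
  exact: between_cauchy_schwarz.
pose H (z : R * R) : \bar R :=
  (sech2 z.1 * weight z.1 * between z.1 z.2 * q z.2)%:E.
have mH : measurable_fun setT H.
  apply/measurable_EFinP; apply: measurable_funM; last first.
    exact: (measurableT_comp mq).
  apply: measurable_funM; last exact: measurable_between2.
  apply: measurable_funM.
    exact: (measurableT_comp measurable_sech2).
  exact: (measurableT_comp measurable_weight).
have Hge0 z : (0 <= H z)%E.
  rewrite lee_fin; apply: mulr_ge0; last exact: q_ge0.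
  apply: mulr_ge0; last exact: between_ge0.
  by apply: mulr_ge0; [exact/ltW/sech2_gt0|exact: weight_ge0].
have H1 x : (\int[mu]_s H (x, s) = (sech2 x * weight x * C x)%:E)%E.
  have qb := L1_between x ql; rewrite /C -IZ// -integral_EFinR; last exact: L1Z.
  by apply: eq_integral => s _; rewrite /H/= -mulrA [between _ _ * _]mulrC.
have H2 s : (\int[mu]_x H (x, s) <= ((3^-1) * g s ^+ 2)%:E)%E.
  have [tL tI] := transposed_weight s.
  have := L1Z (q s) tL => qtL.
  have -> : (\int[mu]_x H (x, s) =
      (q s * \int[mu]_x (sech2 x * weight x * between x s))%:E)%E.
    rewrite -IZ// -integral_EFinR//.
    by apply: eq_integral => x _; rewrite /H/= mulrC.
  rewrite lee_fin (le_trans (ler_wpM2l (q_ge0 s) tI))// /q.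
  have s0 := @sech2_gt0 R s; rewrite le_eqVlt; apply/orP; left; apply/eqP.
  by field; rewrite gt_eqF.
have mP : measurable_fun setT (primitive g) by have [] := primitive_locint gl.
have mF : measurable_fun setT (fun x => sech2 x * K x ^+ 2).
  apply: measurable_funM; first exact: measurable_sech2.
  by apply: measurable_funX; exact: measurable_funB.
have F0 x : 0 <= sech2 x * K x ^+ 2.
  by rewrite mulr_ge0 ?sqr_ge0// ltW// sech2_gt0.
have g3L := L1Z 3^-1 gL.
have main : (\int[mu]_x (sech2 x * K x ^+ 2)%:E <= (3^-1 * \int[mu]_x g x ^+ 2)%:E)%E.
  rewrite -IZ// -integral_EFinR//.
  apply: (@le_trans _ _ (\int[mu]_x \int[mu]_s H (x, s))%E).
    apply: ge0_le_integral => //.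
    - by move=> x _; rewrite lee_fin.
    - exact/measurable_EFinP.
    - exact: (@measurable_fun_fubini_tonelli_F _ _ _ _ _ mu H mH Hge0).
    - by move=> x _; rewrite H1 lee_fin.
  have -> : (\int[mu]_x \int[mu]_s H (x, s) = \int[mu]_s \int[mu]_x H (x, s))%E.
    exact: (@fubini_tonelli _ _ _ _ _ mu mu H mH Hge0).
  apply: ge0_le_integral => //.
  - by move=> s _; apply: integral_ge0.
  - exact: (@measurable_fun_fubini_tonelli_G _ _ _ _ _ mu H mH Hge0).
  - by apply/measurable_EFinP; exact: L1_measurable.
have FL : L1 (fun x => sech2 x * K x ^+ 2).
  by apply: L1_ge0 => //; apply: le_lt_trans main _; rewrite ltry.
split => //.
move: main; rewrite integral_EFinR// lee_fin; rewrite /K; lra.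
Qed.

End Inequality.
End Hardy.

(** * The spectral gap *)

Section SpectralGap.
Context {R : realType}.
Local Notation mu := (@lebesgue_measure R).
Implicit Types (a b x y s k : R) (f g w theta S : R -> R) (n : nat).
Local Notation phi := (@phi R).
Local Notation x0 := (@kink_node R).
Local Notation sech2 := (@sech2 R).

Definition weak_deriv f g := forall theta S, smooth theta -> test_function theta ->
  (forall x, is_derive x 1 theta (S x)) ->
  \int[mu]_x (f x * S x) = - \int[mu]_x (g x * theta x).

Lemma flat2_le2 x : flat 2 x <= 2.
Proof.
rewrite /flat; case: ifP => // x0; have x1 : 0 <= x^-1 by rewrite invr_ge0 ltW.
have := @expR_ge1Dxn R x^-1 1 x1; rewrite expRN.
set t := x^-1 in x1 *; have := expR_gt0 t; set e := expR t => e0 h.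
by rewrite ler_pdivrMr//; move: h; rewrite !factS fact0; lra.
Qed.

Lemma flat2_cvg (u : nat -> R) : u n @[n --> \oo] --> +oo ->
  flat 2 (u n) @[n --> \oo] --> (0 : R).
Proof.
move=> uoo; have upos : \forall n \near \oo, 0 < u n.
  by move/cvgryPgt : uoo; exact.
have uV : (u n)^-1 @[n --> \oo] --> (0 : R) by exact/gtr0_cvgV0.
apply: (@squeeze_cvgr _ _ _ _ (cst 0) (fun n => (u n)^-1 * (u n)^-1)).
- near=> n; have u0 : 0 < u n by near: n.
  rewrite /= flat_ge0/= /flat u0 -expr2 ler_piMr ?exprn_ge0 ?invr_ge0 ?(ltW u0)//.
  by rewrite expR_le1 oppr_le0 invr_ge0 ltW.
- exact: cvg_cst.
- by have := cvgM uV uV; rewrite mulr0; exact.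
Unshelve. all: by end_near. Qed.

Lemma cvg_ext (u v : nat -> R) (l : R) : (forall n, u n = v n) ->
  v n @[n --> \oo] --> l -> u n @[n --> \oo] --> l.
Proof. by move=> /funext ->. Qed.

(** The product exp(-1/(x+n)) exp(-1/(n-x)) on ]-n, n[ tends to 1 with bounded
    derivatives that tend to 0. *)
Definition cutoff n x : R := flat 0 (x + n%:R) * flat 0 (n%:R - x).

Definition cutoff' n x : R :=
  flat 2 (x + n%:R) * flat 0 (n%:R - x) - flat 0 (x + n%:R) * flat 2 (n%:R - x).

Lemma smooth_cutoff n : smooth (cutoff n).
Proof.
move=> m; apply: diffnM.
  have -> : (fun x => flat 0 (x + n%:R)) = (fun x : R => flat 0 (1 * x + n%:R)).
    by apply/funext => x; rewrite mul1r.
  exact: (diffn_affine 1 n%:R (diffn_flat m 0)).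
have -> : (fun x => flat 0 (n%:R - x)) = (fun x : R => flat 0 ((-1) * x + n%:R)).
  by apply/funext => x; rewrite mulN1r addrC.
exact: (diffn_affine (-1) n%:R (diffn_flat m 0)).
Qed.

Lemma is_derive_cutoff n x : is_derive x 1 (cutoff n) (cutoff' n x).
Proof.
have d0 (y : R) : is_derive y 1 (flat 0) (flat 2 y).
  by apply: (is_derive_eq (is_derive_flat 0 y)); rewrite mul0r subr0.
have d1 := is_deriveDr (is_derive_id x 1) (is_derive_cst (n%:R : R) x 1).
have d2 := is_deriveBr (is_derive_cst (n%:R : R) x 1) (is_derive_id x 1).
have e1 := @is_derive_compr _ (flat 0) (fun y => y + n%:R) x _ _ (d0 _) d1.
have e2 := @is_derive_compr _ (flat 0) (fun y => n%:R - y) x _ _ (d0 _) d2.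
by apply: (is_derive_eq (is_deriveMr e1 e2)); rewrite /cutoff'; ring.
Qed.

Lemma cutoff_out n x : n%:R < `|x| -> cutoff n x = 0.
Proof.
rewrite ltr_normr /cutoff => /orP[h|h].
  by rewrite [X in _ * X]flat_le0 ?mulr0//; lra.
by rewrite flat_le0 ?mul0r//; lra.
Qed.

Lemma cutoff_norm n x : `|cutoff n x| <= 1.
Proof.
rewrite ger0_norm; last by rewrite mulr_ge0// flat_ge0.
by rewrite -[leRHS]mulr1 ler_pM ?flat_ge0// flat0_le1.
Qed.

Lemma cutoff'_norm n x : `|cutoff' n x| <= 2.
Proof.
have := @flat_ge0 R 0 (x + n%:R); have := @flat_ge0 R 0 (n%:R - x).
have := @flat_ge0 R 2 (x + n%:R); have := @flat_ge0 R 2 (n%:R - x).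
have := flat0_le1 (x + n%:R); have := flat0_le1 (n%:R - x).
have := flat2_le2 (x + n%:R); have := flat2_le2 (n%:R - x).
rewrite /cutoff' ler_norml => *; apply/andP; split; nra.
Qed.

Lemma cvg_arg x : x + n%:R @[n --> \oo] --> +oo /\ n%:R - x @[n --> \oo] --> +oo.
Proof.
split; apply/cvgryPge => A; near=> n.
  by rewrite -lerBlDl; near: n; exact: nbhs_infty_ger.
by rewrite lerBrDr; near: n; exact: nbhs_infty_ger.
Unshelve. all: by end_near. Qed.

Lemma cutoff_cvg x : cutoff n x @[n --> \oo] --> (1 : R).
Proof.
have [h1 h2] := cvg_arg x.
by have := cvgM (flat0_cvg h1) (flat0_cvg h2); rewrite mulr1; exact.
Qed.

Lemma cutoff'_cvg x : cutoff' n x @[n --> \oo] --> (0 : R).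
Proof.
have [h1 h2] := cvg_arg x.
have := cvgB (cvgM (flat2_cvg h1) (flat0_cvg h2)) (cvgM (flat0_cvg h1) (flat2_cvg h2)).
by rewrite mulr0 mul0r subrr; exact.
Qed.

Lemma is_derive_sech2 x : is_derive x 1 sech2 (- 2 * phi x * sech2 x).
Proof.
have d1 := is_deriveXr 2 (is_derive_phi x).
apply: (is_derive_eq (is_deriveBr (is_derive_cst (1 : R) x 1) d1)).
by rewrite -[1 - phi x ^+ 2]/(sech2 x) /=; ring.
Qed.

Lemma L1_sech2M f : measurable_fun setT f -> L1 (fun x => sech2 x * f x ^+ 2) ->
  L1 (fun x => sech2 x * f x).
Proof.
move=> mf fL; apply: L1_dom (L1D (@L1_sech2 R) fL) => [|x].
  by apply: measurable_funM => //; exact: measurable_sech2.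
have s0 := ltW (@sech2_gt0 R x).
by rewrite normrM (ger0_norm s0) -{2}[sech2 x]mulr1 -mulrDr ler_wpM2l// norm_le_sqr.
Qed.

Lemma L1_sech2_bounded f w k : measurable_fun setT w -> (forall x, `|w x| <= k) ->
  L1 (fun x => sech2 x * f x) -> L1 (fun x => sech2 x * w x * f x).
Proof.
move=> mw wk fL; have -> : (fun x => sech2 x * w x * f x) = (fun x => w x * (sech2 x * f x)).
  by apply/funext => x; ring.
apply: L1_dom (L1Z k (L1_norm fL)) => [|x].
  by apply: measurable_funM => //; exact: L1_measurable.
by rewrite normrM ler_wpM2r.
Qed.

Lemma L1M f g : measurable_fun setT f -> measurable_fun setT g ->
  L1 (fun x => f x ^+ 2) -> L1 (fun x => g x ^+ 2) -> L1 (fun x => f x * g x).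
Proof.
move=> mf mg fL gL; apply: L1_dom (L1D fL gL) => [|x]; first exact: measurable_funM.
rewrite ler_norml; have := sqr_ge0 (f x + g x); have := sqr_ge0 (f x - g x).
by set p := f x; set q := g x => h1 h2; apply/andP; split; nra.
Qed.

Lemma phi_norm x : `|phi x| <= 1.
Proof. by rewrite ler_norml; have /andP[h1 h2] := phi_itv x; rewrite !ltW. Qed.

Lemma L1_sech2_sqr : L1 (fun x => sech2 x ^+ 2).
Proof.
apply: L1_dom (@L1_sech2 R) => [|x]; first by apply: measurable_funX; exact: measurable_sech2.
have s0 := ltW (@sech2_gt0 R x).
by rewrite ger0_norm ?sqr_ge0// expr2 -[leRHS]mulr1 ler_wpM2l// sech2_le1.
Qed.

(** sech^2 does not have compact support, but sech^2 times a cutoff does, and all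
    the integrands are dominated by multiples of sech^2 |f| and sech^2 |g|. *)
Lemma weak_deriv_sech2 f g : measurable_fun setT f -> measurable_fun setT g ->
  L1 (fun x => sech2 x * f x ^+ 2) -> L1 (fun x => g x ^+ 2) -> weak_deriv f g ->
  \int[mu]_x (g x * sech2 x) = 2 * \int[mu]_x (sech2 x * phi x * f x).
Proof.
move=> mf mg fL gL fg.
have sfL := L1_sech2M mf fL.
have ms := @measurable_sech2 R; have mp := @measurable_phi R.
have gsL := L1M mg ms gL L1_sech2_sqr.
pose theta n x := sech2 x * cutoff n x.
pose S n x := (- 2 * phi x * sech2 x) * cutoff n x + sech2 x * cutoff' n x.
have dt n x : is_derive x 1 (theta n) (S n x).
  exact: (is_deriveMr (is_derive_sech2 x) (is_derive_cutoff n x)).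
have st n : smooth (theta n).
  by move=> m; apply: diffnM; [exact: smooth_sech2|exact: smooth_cutoff].
have tt n : test_function (theta n).
  apply: (@smooth_test _ _ (- n%:R) n%:R) => // x.
  by rewrite -ler_norml -ltNge /theta => /cutoff_out ->; rewrite mulr0.
have mc n : measurable_fun setT (cutoff n) by apply: smooth_measurable; exact: smooth_cutoff.
have mc' n : measurable_fun setT (cutoff' n).
  have mfl (k : nat) : measurable_fun setT (@flat R k).
    by apply: smooth_measurable => m; exact: diffn_flat.
  have m1 : measurable_fun setT (fun x : R => x + n%:R) by exact: measurable_funD.
  have m2 : measurable_fun setT (fun x : R => n%:R - x) by exact: measurable_funB.
  apply: measurable_funB; apply: measurable_funM.
  - exact: (measurableT_comp (mfl 2%N) m1).
  - exact: (measurableT_comp (mfl 0%N) m2).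
  - exact: (measurableT_comp (mfl 0%N) m1).
  - exact: (measurableT_comp (mfl 2%N) m2).
have [|||_ H1] := @I_dominated R (fun n x => g x * theta n x) (fun x => g x * sech2 x)
    _ _ _ _ (L1_norm gsL).
- by move=> n; apply: measurable_funM => //; apply: measurable_funM.
- move=> x.
  have h : (g x * sech2 x) * cutoff n x @[n --> \oo] --> (g x * sech2 x) * 1.
    by apply: cvgM; [exact: cvg_cst|exact: cutoff_cvg].
  rewrite mulr1 in h; apply: (cvg_ext _ h) => n; by rewrite /theta /= mulrA.
- move=> n x; rewrite /theta mulrA normrM -[leRHS]mulr1 ler_wpM2l//; exact: cutoff_norm.
have [|||_ H2] := @I_dominated R (fun n x => f x * S n x) (fun x => - 2 * (sech2 x * phi x * f x))
    _ _ _ _ (L1Z 4 (L1_norm sfL)).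
- move=> n; apply: measurable_funM => //; apply: measurable_funD.
    by do 2 apply: measurable_funM => //; apply: measurable_funM => //.
  by apply: measurable_funM.
- move=> x; pose A := - 2 * (sech2 x * phi x * f x).
  have h : A * cutoff n x + sech2 x * f x * cutoff' n x @[n --> \oo] --> A * 1 + sech2 x * f x * 0.
    apply: cvgD; apply: cvgM; [exact: cvg_cst|exact: cutoff_cvg|exact: cvg_cst|exact: cutoff'_cvg].
  rewrite mulr1 mulr0 addr0 in h; apply: (cvg_ext _ h) => n.
  by rewrite /S /A /=; ring.
- move=> n x; have -> : f x * S n x = (sech2 x * f x) * (- 2 * phi x * cutoff n x + cutoff' n x).
    by rewrite /S; ring.
  rewrite normrM mulrC ler_wpM2r//.
  have -> : (4 : R) = 2 + 2 by ring.
  rewrite (le_trans (ler_normD _ _))// lerD ?cutoff'_norm//.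
  rewrite (normrM _ (cutoff n x)) (normrM (- 2) (phi x)) normrN (ger0_norm (ler0n _ 2)).
  rewrite -mulrA -[leRHS]mulr1 ler_wpM2l//.
  by rewrite -[leRHS]mulr1 ler_pM ?cutoff_norm ?phi_norm.
have sfp : L1 (fun x => sech2 x * phi x * f x).
  exact: (L1_sech2_bounded mp phi_norm sfL).
rewrite IZ// in H2.
have e n : \int[mu]_x (f x * S n x) = - \int[mu]_x (g x * theta n x) by exact: fg.
have H3 : \int[mu]_x (f x * S n x) @[n --> \oo] --> - \int[mu]_x (g x * sech2 x).
  by under eq_fun do rewrite e; exact: cvgN.
have E := cvg_unique (@Rhausdorff R) H2 H3.
by rewrite -[LHS]opprK -E mulNr opprK.
Qed.

Lemma ae_I f g : measurable_fun setT f -> measurable_fun setT g ->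
  {ae mu, forall x, f x = g x} -> \int[mu]_x f x = \int[mu]_x g x.
Proof.
move=> mf mg fg; rewrite /Rintegral; congr fine.
apply: ae_eq_integral => //; try exact/measurable_EFinP.
move: fg; apply: (@filterS _ _ (ae_filter_ringOfSetsType mu)) => x e _.
by rewrite /= e.
Qed.

Lemma primitive_lin g k x : locally_integrable setT g ->
  primitive (fun s => g s - k * sech2 s) x = primitive g x - k * phi x.
Proof.
move=> gl; rewrite -primitive_sech2 /primitive.
have L w : locally_integrable setT w -> L1 (fun s => w s * signed_indic x s).
  move=> wl; apply: (@locint_bounded _ _ _ (- `|x|) `|x| 1) => //.
  - exact: measurable_signed_indic.
  - exact: signed_indic_norm.
  - by move=> s; exact: signed_indic_out.
have Ls := L _ (@locint_sech2 R).
rewrite -IZ// -IB//; [|exact: L|exact: L1Z].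
by apply: eq_I => s; rewrite mulrBl mulrA.
Qed.

Lemma quartic_moment (c0 c1 c2 c4 : R) :
  L1 (fun x => sech2 x * (c0 + c1 * phi x + c2 * phi x ^+ 2 + c4 * phi x ^+ 4)) /\
  \int[mu]_x (sech2 x * (c0 + c1 * phi x + c2 * phi x ^+ 2 + c4 * phi x ^+ 4)) =
  2 * c0 + 2 / 3 * c2 + 2 / 5 * c4.
Proof.
pose p (y : R) := c0 + c1 * y + c2 * y ^+ 2 + c4 * y ^+ 4.
pose P (y : R) := c0 * y + c1 / 2 * y ^+ 2 + c2 / 3 * y ^+ 3 + c4 / 5 * y ^+ 5.
have dP y : is_derive y 1 P (p y).
  have dX (k : R) n := is_deriveMr (is_derive_cst k y 1) (is_deriveXr n (is_derive_id y 1)).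
  have d1 := is_deriveMr (is_derive_cst c0 y 1) (is_derive_id y 1).
  apply: (is_derive_eq (is_deriveDr (is_deriveDr (is_deriveDr d1 (dX (c1 / 2) 2%N))
    (dX (c2 / 3) 3%N)) (dX (c4 / 5) 5%N))).
  by rewrite /p /=; field.
have sp : smooth p.
  have sid : smooth (fun y : R => y).
    by case=> [//|n]; exists (fun=> 1) => [y|]; [exact: is_derive_id|exact: diffn_cst].
  have sX (k : R) n : smooth (fun y => k * y ^+ n).
    elim: n => [|n IH] q; first by apply: diffnM; exact: diffn_cst.
    have -> : (fun y : R => k * y ^+ n.+1) = (fun y => y * (k * y ^+ n)).
      by apply/funext => y; rewrite exprS mulrCA.
    by apply: diffnM; [exact: sid|exact: IH].
  move=> q; apply: diffnD; last exact: sX.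
  apply: diffnD; last exact: sX.
  by apply: diffnD; [exact: diffn_cst|exact: (sX c1 1%N)].
have cp := smooth_continuous sp.
have pk (y : R) : -1 < y < 1 -> `|p y| <= `|c0| + `|c1| + `|c2| + `|c4|.
  move=> /andP[y1 y2]; have yn : `|y| <= 1 by rewrite ler_norml !ltW.
  have H (k : R) n : `|k * y ^+ n| <= `|k|.
    by rewrite normrM normrX -[leRHS]mulr1 ler_wpM2l// exprn_ile1.
  rewrite /p; do 3 (rewrite (le_trans (ler_normD _ _))// lerD ?H//).
  exact: (H c1 1%N).
split; first exact: (L1_moment cp pk).
by rewrite (moment dP cp pk) /P; field.
Qed.

Lemma moments : [/\ \int[mu]_x sech2 x = 2, \int[mu]_x (sech2 x * phi x) = 0,
  \int[mu]_x (sech2 x * phi x ^+ 2) = 2 / 3, \int[mu]_x sech2 x ^+ 2 = 4 / 3 &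
  \int[mu]_x (sech2 x * (1 - 5 / 4 * sech2 x) ^+ 2) = 3^-1].
Proof.
have s2 x : sech2 x = 1 - phi x ^+ 2 by [].
have H (c0 c1 c2 c4 : R) w k :
    (forall x, sech2 x * (c0 + c1 * phi x + c2 * phi x ^+ 2 + c4 * phi x ^+ 4) = w x) ->
    2 * c0 + 2 / 3 * c2 + 2 / 5 * c4 = k -> \int[mu]_x w x = k.
  by move=> e <-; have [_ <-] := quartic_moment c0 c1 c2 c4; apply/esym/eq_I.
split.
- by apply: (H 1 0 0 0) => [x|]; ring.
- by apply: (H 0 1 0 0) => [x|]; ring.
- by apply: (H 0 0 1 0) => [x|]; ring.
- by apply: (H 1 0 (-1) 0) => [x|]; [rewrite s2; ring|field].
- by apply: (H 16^-1 0 (- 5 / 8) (25 / 16)) => [x|]; [rewrite s2; field|field].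
Qed.

Section Gap.
Variables f g : R -> R.
Hypotheses (fl : locally_integrable setT f) (mg : measurable_fun setT g).
Hypotheses (fL : L1 (fun x => sech2 x * f x ^+ 2)) (gL : L1 (fun x => g x ^+ 2)).
Hypothesis fg : weak_deriv f g.
Hypothesis orth1 : \int[mu]_x (sech2 x * phi x * f x) = 0.
Hypothesis orth2 : \int[mu]_x (sech2 x * sech2 x * f x) = 0.

Let m := \int[mu]_x (sech2 x * f x).

Let mf : measurable_fun setT f. Proof. by have [] := fl. Qed.

Let sfL : L1 (fun x => sech2 x * f x). Proof. exact: L1_sech2M. Qed.

Let spfL : L1 (fun x => sech2 x * phi x * f x).
Proof. by apply: L1_sech2_bounded sfL; [exact: measurable_phi|exact: phi_norm]. Qed.

Let ssfL : L1 (fun x => sech2 x * sech2 x * f x).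
Proof.
apply: (@L1_sech2_bounded _ _ 1) sfL => [|x]; first exact: measurable_sech2.
by rewrite ger0_norm ?sech2_le1// ltW// sech2_gt0.
Qed.

(** 1 - (5/4) sech^2 is the component of the constant 1 orthogonal to phi' in H, with
    squared norm 1/3; as f is orthogonal to phi', m is its inner product with f. *)
Lemma mean_bound : 3 * m ^+ 2 <= \int[mu]_x (sech2 x * f x ^+ 2).
Proof.
have [_ _ _ _ I5] := moments.
have L5 : L1 (fun x => sech2 x * (1 - 5 / 4 * sech2 x) ^+ 2).
  have [qL _] := quartic_moment 16^-1 0 (- 5 / 8) (25 / 16).
  by apply: eq_L1 qL => x; have -> : sech2 x = 1 - phi x ^+ 2 by []; field.
have : 0 <= \int[mu]_x (sech2 x * (f x - 3 * m * (1 - 5 / 4 * sech2 x)) ^+ 2).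
  by apply: Rintegral_ge0 => x _; rewrite mulr_ge0 ?sqr_ge0// ltW// sech2_gt0.
have -> : \int[mu]_x (sech2 x * (f x - 3 * m * (1 - 5 / 4 * sech2 x)) ^+ 2) =
  \int[mu]_x (sech2 x * f x ^+ 2 + (- 6 * m) * (sech2 x * f x) +
    (15 / 2 * m) * (sech2 x * sech2 x * f x) +
    (9 * m ^+ 2) * (sech2 x * (1 - 5 / 4 * sech2 x) ^+ 2)).
  by apply: eq_I => x; field.
rewrite !ID ?IZ//; try (by do ?[exact: L1Z | apply: L1D]).
rewrite orth2 I5 -/m; lra.
Qed.

(** Apply [hardy] to the derivative g - b sech^2 of f - a - b phi, where a and b make this
    function vanish at both nodes.  The cross terms in b vanish, by orthogonality of f to
    phi and by parity. *)
Lemma spectral_gap : 5 / 2 * \int[mu]_x (sech2 x * f x ^+ 2) <= \int[mu]_x g x ^+ 2.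
Proof.
have [I1 I2 I3 I4 _] := moments.
have gl : locally_integrable setT g := locint_L2 mg gL.
have [c fc] : exists c, {ae mu, forall x, f x = c + primitive g x}.
  by apply: (weak_primitive fl gl) => theta S st tt _ _; exact: fg.
(* the slope in tanh x of the chord of f between the nodes, which are 2/3 apart *)
pose b := (primitive g x0 - primitive g (- x0)) * (3 / 2).
pose gam x := g x - b * sech2 x.
have ms := @measurable_sech2 R; have mp := @measurable_phi R.
have mgam : measurable_fun setT gam by apply: measurable_funB => //; exact: measurable_funM.
have gsL := L1M mg ms gL L1_sech2_sqr.
have gamE : (fun x => gam x ^+ 2) =
    (fun x => g x ^+ 2 + (- 2 * b) * (g x * sech2 x) + b ^+ 2 * sech2 x ^+ 2).
  by apply/funext => x; rewrite /gam; ring.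
have gamL : L1 (fun x => gam x ^+ 2).
  rewrite gamE; apply: L1D; last by apply: L1Z; exact: L1_sech2_sqr.
  by apply: L1D => //; exact: L1Z.
have gamI : \int[mu]_x gam x ^+ 2 = \int[mu]_x g x ^+ 2 + 4 / 3 * b ^+ 2.
  rewrite gamE !ID ?IZ//; try (by do ?[exact: L1_sech2_sqr | exact: L1Z | apply: L1D | apply: L1Z]).
  by rewrite (weak_deriv_sech2 mf mg fL gL fg) orth1 I4; ring.
have pE x : primitive gam x = primitive g x - b * phi x by exact: primitive_lin.
have gx0 : primitive gam (- x0) = primitive gam x0.
  by rewrite !pE phiN phi_node /b; field.
have [_] := hardy mgam gamL gx0.
pose a := c + primitive gam x0.
have -> : \int[mu]_x (sech2 x * (primitive gam x - primitive gam x0) ^+ 2) =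
    \int[mu]_x (sech2 x * (f x - a - b * phi x) ^+ 2).
  apply: ae_I.
  - have [mP _ _] := primitive_locint (locint_L2 mgam gamL).
    by apply: measurable_funM => //; apply: measurable_funX; exact: measurable_funB.
  - apply: measurable_funM => //; apply: measurable_funX; apply: measurable_funB.
      exact: measurable_funB.
    exact: measurable_funM.
  move: fc; apply: (@filterS _ _ (ae_filter_ringOfSetsType mu)) => x ->.
  by rewrite pE /a; congr (_ * _ ^+ 2); ring.
have spL : L1 (fun x => sech2 x * phi x).
  by have [qL _] := quartic_moment 0 1 0 0; apply: eq_L1 qL => x; ring.
have sppL : L1 (fun x => sech2 x * phi x ^+ 2).
  by have [qL _] := quartic_moment 0 0 1 0; apply: eq_L1 qL => x; ring.
have sL := @L1_sech2 R.
have -> : \int[mu]_x (sech2 x * (f x - a - b * phi x) ^+ 2) =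
  \int[mu]_x (sech2 x * f x ^+ 2 + (- 2 * a) * (sech2 x * f x) +
    (- 2 * b) * (sech2 x * phi x * f x) + a ^+ 2 * sech2 x +
    (2 * a * b) * (sech2 x * phi x) + b ^+ 2 * (sech2 x * phi x ^+ 2)).
  by apply: eq_I => x; ring.
rewrite !ID ?IZ//; try (by do ?[exact: L1Z | apply: L1D]).
rewrite orth1 I1 I2 I3 gamI -/m.
have := mean_bound.
have := sqr_ge0 b; have := sqr_ge0 (a - m / 2).
set D := \int[mu]_x _; set M := \int[mu]_x _; rewrite sqrrB; lra.
Qed.

End Gap.
End SpectralGap.

(** * Complex-valued weak derivatives *)

Section WeakDerivatives.
Context {R : realType}.
Local Notation mu := (@lebesgue_measure R).
Implicit Types (x y k : R) (f g w theta : R -> R) (F G : R -> R[i]) (n : nat).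
Local Notation phi := (@phi R).
Local Notation sech2 := (@sech2 R).

Lemma normc_sqr (z : R[i]) : Normc.normc z ^+ 2 = complex.Re z ^+ 2 + complex.Im z ^+ 2.
Proof. by case: z => a b /=; rewrite sqr_sqrtr// addr_ge0// sqr_ge0. Qed.

Lemma test_smooth theta : test_function theta -> smooth theta.
Proof.
move=> [dt _] n; elim: n theta dt => [//|n IH] theta dt.
exists (derive1 theta) => [x|].
  by rewrite derive1E; apply: derivableP; exact: (dt 0%N).
apply: IH => m x; have := dt m.+1 x.
by rewrite /derive1n iterSr.
Qed.

Lemma derive1_test theta : test_function theta -> test_function (derive1 theta).
Proof.
move=> tt; have [dt [M tM]] := tt; split.
  by move=> m x; have := dt m.+1 x; rewrite /derive1n iterSr.
exists M => x Mx.
have [a Ma] : exists M' : R, M < M' /\ M' < `|x| by exists ((M + `|x|) / 2); split; lra.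
have nx : \forall y \near x, cst 0 y = theta y.
  have : \forall y \near x, M < `|y|.
    have := @norm_continuous _ R x; move=> /cvgr_gt; exact.
  by apply: filterS => y /tM ->.
by rewrite derive1E -(near_eq_derive _ nx) derive_cst.
Qed.

Lemma weak_deriv_of f g : (forall theta, test_function theta ->
    \int[mu]_x (f x * derive1 theta x) = - \int[mu]_x (g x * theta x)) ->
  weak_deriv f g.
Proof.
move=> H theta S st tt dt; rewrite -H//; apply: eq_I => x.
by rewrite derive1E; congr (_ * _); apply/esym/derive_val.
Qed.

Lemma ae0_test w : locally_integrable setT w ->
  (forall theta, test_function theta -> \int[mu]_x (w x * theta x) = 0) ->
  {ae mu, forall x, w x = 0}.
Proof.
move=> wl w0; apply: (ae0_itv wl); apply: itv_integral0 => // theta _; exact: w0.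
Qed.

Lemma cof_weak f g : locally_integrable setT f -> locally_integrable setT g ->
  (forall theta, test_function theta ->
    \int[mu]_x (f x * derive1 theta x) = - \int[mu]_x (g x * theta x)) ->
  is_weak_derivative (cof f) (cof g).
Proof.
move=> fl gl H; split.
- by split => //; exact: locint_cst.
- by split => //; exact: locint_cst.
move=> theta tt; rewrite /cintegral /cof /=.
have z h : \int[mu]_x (f x * 0 + 0 * h x) = 0 :> R.
  by under eq_Rintegral do rewrite mulr0 mul0r addr0; rewrite Rintegral_cst// mul0r.
have z' h : \int[mu]_x (g x * 0 + 0 * h x) = 0 :> R.
  by under eq_Rintegral do rewrite mulr0 mul0r addr0; rewrite Rintegral_cst// mul0r.
rewrite z z'; apply/eqP; rewrite eq_complex /= oppr0 eqxx andbT; apply/eqP.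
under eq_Rintegral do rewrite mul0r subr0.
under [in RHS]eq_Rintegral do rewrite mul0r subr0.
exact: H.
Qed.

Lemma weak_Re F G : is_weak_derivative F G ->
  [/\ locally_integrable setT (fun x => complex.Re (F x)),
      locally_integrable setT (fun x => complex.Re (G x)) &
      forall theta, test_function theta ->
      \int[mu]_x (complex.Re (F x) * derive1 theta x) =
      - \int[mu]_x (complex.Re (G x) * theta x)].
Proof.
move=> [[Fr _] [Gr _] H]; split => // theta /H/(congr1 (@complex.Re R)) /= E.
etransitivity; [etransitivity; [|exact: E]|].
  by apply: eq_I => x; case: (F x) => a b /=; rewrite mulr0 subr0.
by congr (- _); apply: eq_I => x; case: (G x) => a b /=; rewrite mulr0 subr0.
Qed.

Lemma weak_Im F G : is_weak_derivative F G ->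
  [/\ locally_integrable setT (fun x => complex.Im (F x)),
      locally_integrable setT (fun x => complex.Im (G x)) &
      forall theta, test_function theta ->
      \int[mu]_x (complex.Im (F x) * derive1 theta x) =
      - \int[mu]_x (complex.Im (G x) * theta x)].
Proof.
move=> [[_ Fr] [_ Gr] H]; split => // theta /H/(congr1 (@complex.Im R)) /= E.
etransitivity; [etransitivity; [|exact: E]|].
  by apply: eq_I => x; case: (F x) => a b /=; rewrite mulr0 add0r.
by congr (- _); apply: eq_I => x; case: (G x) => a b /=; rewrite mulr0 add0r.
Qed.

Lemma wderivP F G : is_weak_derivative F G -> is_weak_derivative F (wderiv F).
Proof. by move=> FG; apply: (xgetPex (fun=> 0)); exists G. Qed.

Lemma ae_eq_weak f g w : locally_integrable setT g -> locally_integrable setT w ->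
  (forall theta, test_function theta ->
    \int[mu]_x (f x * derive1 theta x) = - \int[mu]_x (g x * theta x)) ->
  (forall theta, test_function theta ->
    \int[mu]_x (f x * derive1 theta x) = - \int[mu]_x (w x * theta x)) ->
  {ae mu, forall x, g x = w x}.
Proof.
move=> gl wl fg fw; have gwl := locally_integrableB gl wl.
have [|N [mN N0 NP]] := @ae0_test _ gwl.
  move=> theta tt; have st := test_smooth tt.
  rewrite (@eq_I _ _ (fun x => g x * theta x - w x * theta x)); last first.
    by move=> x; rewrite mulrBl.
  rewrite IB; [|exact: locint_test..].
  by apply/eqP; rewrite subr_eq0 -eqr_opp -fg// fw.
exists N; split => // x /= gw; apply: NP => /= /eqP; rewrite subr_eq0 => /eqP.
exact: gw.
Qed.

Lemma sqnormL2_wderiv f g : locally_integrable setT f -> locally_integrable setT g ->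
  (forall theta, test_function theta ->
    \int[mu]_x (f x * derive1 theta x) = - \int[mu]_x (g x * theta x)) ->
  [/\ measurable_fun setT (fun x => Normc.normc (wderiv (cof f) x) ^+ 2),
    {ae mu, forall x, Normc.normc (wderiv (cof f) x) ^+ 2 = g x ^+ 2} &
    sqnormL2 setT (wderiv (cof f)) = (\int[mu]_x (g x ^+ 2)%:E)%E].
Proof.
move=> fl gl fg; have W := wderivP (cof_weak fl gl fg).
have [_ Rl RW] := weak_Re W; have [_ Il IW] := weak_Im W.
have mW : measurable_fun setT (fun x => Normc.normc (wderiv (cof f) x) ^+ 2).
  under eq_fun do rewrite normc_sqr.
  have [mR _ _] := Rl; have [mI _ _] := Il.
  by apply: measurable_funD; apply: measurable_funX.
have aR := ae_eq_weak Rl gl RW fg.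
have aI : {ae mu, forall x, complex.Im (wderiv (cof f) x) = 0}.
  apply: (ae0_test Il) => theta tt.
  have := IW theta tt; under eq_Rintegral do rewrite /= mul0r.
  by rewrite Rintegral_cst// mul0r => /eqP; rewrite eq_sym oppr_eq0 => /eqP.
have aW : {ae mu, forall x, Normc.normc (wderiv (cof f) x) ^+ 2 = g x ^+ 2}.
  have := @filterI _ _ (ae_filter_ringOfSetsType mu) _ _ aR aI.
  apply: (@filterS _ _ (ae_filter_ringOfSetsType mu)) => x [r i].
  by rewrite normc_sqr r i expr0n addr0.
split => //; rewrite /sqnormL2.
have [mg _ _] := gl.
apply: ae_eq_integral => //.
- exact/measurable_EFinP.
- by apply/measurable_EFinP; exact: measurable_funX.
move: aW; apply: (@filterS _ _ (ae_filter_ringOfSetsType mu)) => x e _.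
by rewrite e.
Qed.

End WeakDerivatives.

(** * The energy of a perturbed kink *)

Section Energy.
Context {R : realType}.
Local Notation mu := (@lebesgue_measure R).
Implicit Types (x y k : R) (f g u v : R -> R).
Local Notation phi := (@phi R).
Local Notation sech2 := (@sech2 R).

Lemma phi_weak theta : test_function theta ->
  \int[mu]_x (phi x * derive1 theta x) = - \int[mu]_x (sech2 x * theta x).
Proof.
move=> tt; have ts := derive1_test tt; have st := test_smooth tt.
have dt x : is_derive x 1 theta (derive1 theta x).
  by rewrite derive1E; apply: derivableP; exact: (tt.1 0%N).
have [_ <-] := primitive_weak (@locint_sech2 R) st tt (test_smooth ts) ts dt.
by apply: eq_I => x; rewrite primitive_sech2.
Qed.

Lemma locint_phi : locally_integrable setT phi.
Proof. by apply: locint_continuous; apply: smooth_continuous; exact: smooth_phi. Qed.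

Lemma derive1_phi : derive1 phi = sech2.
Proof. by apply/funext => x; rewrite derive1E; apply: derive_val; exact: is_derive_phi. Qed.

Lemma Lambda_phi : Lambda (cof phi) = (2 * \int[mu]_x sech2 x ^+ 2)%:E.
Proof.
have [mW aW _] := sqnormL2_wderiv locint_phi (@locint_sech2 R) phi_weak.
have sL := @L1_sech2_sqr R.
rewrite -IZ// -integral_EFinR; last exact: L1Z.
have E x : 1 - Normc.normc (cof phi x) ^+ 2 = sech2 x.
  by rewrite normc_sqr /= expr0n addr0.
apply: ae_eq_integral => //.
- apply/measurable_EFinP; apply: measurable_funD => //.
  by under eq_fun do rewrite E; apply: measurable_funX; exact: measurable_sech2.
- by apply/measurable_EFinP; apply: L1_measurable; exact: L1Z.
move: aW; apply: (@filterS _ _ (ae_filter_ringOfSetsType mu)) => x e _.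
by rewrite e E -mulr2n mulr_natl.
Qed.

Lemma coercivity f g : locally_integrable setT f -> measurable_fun setT g ->
  L1 (fun x => sech2 x * f x ^+ 2) -> L1 (fun x => g x ^+ 2) -> weak_deriv f g ->
  \int[mu]_x (sech2 x * phi x * f x) = 0 ->
  \int[mu]_x (sech2 x * sech2 x * f x) = 0 ->
  \int[mu]_x (sech2 x * f x ^+ 2) + \int[mu]_x g x ^+ 2 <=
  7 * (\int[mu]_x g x ^+ 2 - 2 * \int[mu]_x (sech2 x * f x ^+ 2)).
Proof.
by move=> fl mg fL gL fg o1 o2; have := spectral_gap fl mg fL gL fg o1 o2; lra.
Qed.

Lemma sqnormH_cof f : sqnormH (cof f) = (\int[mu]_x (sech2 x * f x ^+ 2)%:E)%E.
Proof. by apply: eq_integral => x _; rewrite normc_sqr /= expr0n addr0. Qed.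

Lemma sqnormL2_cof f : sqnormL2 setT (cof f) = (\int[mu]_x (f x ^+ 2)%:E)%E.
Proof. by apply: eq_integral => x _; rewrite normc_sqr /= expr0n addr0. Qed.

Lemma innerH_cof f g : innerH (cof f) (cof g) = 0 ->
  \int[mu]_x (sech2 x * f x * g x) = 0.
Proof.
move=> /(congr1 (@complex.Re R)) /= <-; apply: eq_I => x /=.
by rewrite /sech2; ring.
Qed.

End Energy.

Theorem lemma6p1 (R : realType) :
  exists2 C : R, 0 < C &
  forall (psi : R -> R[i]) (u v : R -> R),
    (forall x : R, psi x = (phi x + u x) +i* v x) ->
    inSigma psi -> inH psi ->
    innerH (cof phi) (cof u) = 0 -> innerH (cof (derive1 phi)) (cof u) = 0 ->
    innerH (cof phi) (cof v) = 0 -> innerH (cof (derive1 phi)) (cof v) = 0 ->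
    let eta := fun x : R => Normc.normc (psi x) ^+ 2 - phi x ^+ 2 in
    (C%:E * (sqnormH1m (cof u) + sqnormH1m (cof v) + sqnormL2 setT (cof eta))
     <= Lambda psi - Lambda (cof phi))%E.
Proof.
exists (7^-1); first by rewrite invr_gt0.
move=> psi u v psiE [[_ [G0 psiG _]] WL BL] [_ psiH] u1 u2 v1 v2.
cbv zeta; set eta := fun x : R => _ - _.
have psiW := wderivP psiG.
have [al G1l G1w] := weak_Re psiW; have [vl G2l G2w] := weak_Im psiW.
pose G1 x := complex.Re (wderiv psi x); pose G2 x := complex.Im (wderiv psi x).
have {}al : locally_integrable setT (fun x => phi x + u x).
  by move: al; under eq_fun do rewrite psiE.
have {}vl : locally_integrable setT v.
  by move: vl; under eq_fun do rewrite psiE.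
have {}G1w theta : test_function theta ->
    \int[lebesgue_measure]_x ((phi x + u x) * derive1 theta x) =
    - \int[lebesgue_measure]_x (G1 x * theta x).
  by move=> /G1w; under eq_Rintegral do rewrite psiE.
have {}G2w theta : test_function theta ->
    \int[lebesgue_measure]_x (v x * derive1 theta x) =
    - \int[lebesgue_measure]_x (G2 x * theta x).
  by move=> /G2w; under eq_Rintegral do rewrite psiE.
have ul : locally_integrable setT u.
  have := locally_integrableB al (@locint_phi R); congr (locally_integrable _ _).
  by apply/funext => x /=; rewrite addrC addKr.
have [mu' _ _] := ul; have [mv _ _] := vl.
have [mG1 _ _] := G1l; have [mG2 _ _] := G2l.
pose g x := G1 x - sech2 x.
have gl : locally_integrable setT g by exact: locally_integrableB G1l (@locint_sech2 R).
have [mg _ _] := gl.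
have gw theta : test_function theta ->
    \int[lebesgue_measure]_x (u x * derive1 theta x) =
    - \int[lebesgue_measure]_x (g x * theta x).
  move=> tt; have st := test_smooth tt.
  have td := derive1_test tt; have sd := test_smooth td.
  rewrite (@eq_I _ _ (fun x =>
    (phi x + u x) * derive1 theta x - phi x * derive1 theta x)); last first.
    by move=> x; ring.
  rewrite IB; [|exact: locint_test..|exact: locint_test (@locint_phi R) _ _].
  rewrite G1w// phi_weak// /g (@eq_I _ (fun x => (G1 x - sech2 x) * theta x)
    (fun x => G1 x * theta x - sech2 x * theta x)); last by move=> x; rewrite mulrBl.
  rewrite IB ?opprB ?opprK 1?addrC//; [exact: locint_test|].
  exact: locint_test (@locint_sech2 R) _ _.
have [_ _ uW] := sqnormL2_wderiv ul gl gw.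
have [_ _ vW] := sqnormL2_wderiv vl G2l G2w.
have mphi := @measurable_phi R; have ms := @measurable_sech2 R.
have s0 x : 0 <= sech2 x :> R by exact/ltW/sech2_gt0.
have WL1 : L1 (fun x => G1 x ^+ 2 + G2 x ^+ 2).
  apply: L1_ge0 => [|x|]; first by apply: measurable_funD; apply: measurable_funX.
    by rewrite addr_ge0 ?sqr_ge0.
  have [_] := WL; rewrite /sqnormL2.
  by under eq_integral do rewrite normc_sqr.
have G1L : L1 (fun x => G1 x ^+ 2).
  apply: L1_dom WL1 => [|x]; first exact: measurable_funX.
  by rewrite ger0_norm ?sqr_ge0// lerDl sqr_ge0.
have G2L : L1 (fun x => G2 x ^+ 2).
  apply: L1_dom WL1 => [|x]; first exact: measurable_funX.
  by rewrite ger0_norm ?sqr_ge0// lerDr sqr_ge0.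
have gL : L1 (fun x => g x ^+ 2).
  apply: L1_dom (L1Z 2 (L1D G1L (@L1_sech2_sqr R))) => [|x]; first exact: measurable_funX.
  rewrite ger0_norm ?sqr_ge0// /g; have := sqr_ge0 (G1 x + sech2 x); lra.
pose B x := 1 - Normc.normc (psi x) ^+ 2.
have mB : measurable_fun setT B by have [[]] := BL.
have B2L : L1 (fun x => B x ^+ 2).
  apply: L1_ge0 => [|x|]; [exact: measurable_funX|exact: sqr_ge0|].
  by have [_] := BL; rewrite sqnormL2_cof.
have psi2 x : Normc.normc (psi x) ^+ 2 = (phi x + u x) ^+ 2 + v x ^+ 2.
  by rewrite normc_sqr psiE.
have HL : L1 (fun x => sech2 x * ((phi x + u x) ^+ 2 + v x ^+ 2)).
  apply: L1_ge0 => [|x|].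
  - apply: measurable_funM => //; apply: measurable_funD; apply: measurable_funX => //.
    exact: measurable_funD.
  - by rewrite mulr_ge0// addr_ge0 ?sqr_ge0.
  have [_] := psiH; rewrite /sqnormL2; congr (_ < _)%E; apply: eq_integral => x _.
  rewrite normc_sqr psiE /= !mul0r subr0 addr0.
  have ss : Num.sqrt (1 - phi x ^+ 2) ^+ 2 = sech2 x by rewrite sqr_sqrtr//; exact: (s0 x).
  by move: ss; set s := Num.sqrt _ => ss; rewrite !exprMn ss mulrDr.
have uL : L1 (fun x => sech2 x * u x ^+ 2).
  apply: L1_dom (L1Z 2 (L1D HL (@L1_sech2 R))) => [|x].
    by apply: measurable_funM => //; exact: measurable_funX.
  rewrite (ger0_norm (mulr_ge0 (s0 x) (sqr_ge0 (u x)))).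
  have H : u x ^+ 2 <= 2 * ((phi x + u x) ^+ 2 + v x ^+ 2 + 1).
    by have := sqr_ge0 (u x + 2 * phi x); have := phi2_lt1 x; have := sqr_ge0 (v x); lra.
  by have := ler_wpM2l (s0 x) H; lra.
have vL : L1 (fun x => sech2 x * v x ^+ 2).
  apply: L1_dom HL => [|x]; first by apply: measurable_funM => //; exact: measurable_funX.
  rewrite (ger0_norm (mulr_ge0 (s0 x) (sqr_ge0 (v x)))).
  by rewrite ler_wpM2l// lerDr sqr_ge0.
have etaE x : eta x = 2 * phi x * u x + u x ^+ 2 + v x ^+ 2.
  by rewrite /eta psi2; ring.
have etaB x : eta x = sech2 x - B x by rewrite /eta /B /sech2; ring.
have etaL : L1 (fun x => eta x ^+ 2).
  apply: L1_dom (L1Z 2 (L1D B2L (@L1_sech2_sqr R))) => [|x].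
    apply: measurable_funX; have -> : eta = (fun x => sech2 x - B x) by apply/funext.
    exact: measurable_funB.
  rewrite ger0_norm ?sqr_ge0// etaB; have := sqr_ge0 (B x + sech2 x); lra.
have {}u1 := innerH_cof u1; have {}v1 := innerH_cof v1.
have {}u2 : \int[lebesgue_measure]_x (sech2 x * sech2 x * u x) = 0.
  by have := innerH_cof u2; rewrite derive1_phi.
have {}v2 : \int[lebesgue_measure]_x (sech2 x * sech2 x * v x) = 0.
  by have := innerH_cof v2; rewrite derive1_phi.
have cu := coercivity ul mg uL gL (weak_deriv_of gw) u1 u2.
have cv := coercivity vl mG2 vL G2L (weak_deriv_of G2w) v1 v2.
have gs0 : \int[lebesgue_measure]_x (g x * sech2 x) = 0.
  by rewrite (weak_deriv_sech2 mu' mg uL gL (weak_deriv_of gw)) u1 mulr0.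
have gsL := L1M mg ms gL (@L1_sech2_sqr R).
have suL : L1 (fun x => sech2 x * phi x * u x).
  exact: (L1_sech2_bounded mphi (@phi_norm R) (L1_sech2M mu' uL)).
have s2L := @L1_sech2_sqr R.
(* the two terms in the last line of E integrate to zero by orthogonality to phi *)
have LE : Lambda psi = (2 * \int[lebesgue_measure]_x sech2 x ^+ 2 +
    (\int[lebesgue_measure]_x g x ^+ 2 - 2 * \int[lebesgue_measure]_x (sech2 x * u x ^+ 2)) +
    (\int[lebesgue_measure]_x G2 x ^+ 2 - 2 * \int[lebesgue_measure]_x (sech2 x * v x ^+ 2)) +
    \int[lebesgue_measure]_x eta x ^+ 2)%:E.
  have E x : Normc.normc (wderiv psi x) ^+ 2 + (1 - Normc.normc (psi x) ^+ 2) ^+ 2 =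
      2 * sech2 x ^+ 2 + (g x ^+ 2 + (- 2) * (sech2 x * u x ^+ 2)) +
      (G2 x ^+ 2 + (- 2) * (sech2 x * v x ^+ 2)) + eta x ^+ 2 +
      (2 * (g x * sech2 x) + (- 4) * (sech2 x * phi x * u x)).
    rewrite normc_sqr -/(G1 x) -/(G2 x) -/(B x).
    have -> : B x = sech2 x - eta x by rewrite etaB; ring.
    have -> : G1 x = g x + sech2 x by rewrite /g; ring.
    by rewrite etaE; ring.
  rewrite /Lambda; under eq_integral do rewrite E.
  have La := L1Z 2 s2L; have Lb := L1Z (- 2) uL; have Lc := L1Z (- 2) vL.
  have Ld := L1Z 2 gsL; have Le := L1Z (- 4) suL.
  have Lf := L1D gL Lb; have Lg := L1D G2L Lc; have Lh := L1D Ld Le.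
  have Li := L1D La Lf; have Lj := L1D Li Lg; have Lk := L1D Lj etaL.
  rewrite integral_EFinR; last exact: L1D Lk Lh.
  rewrite !(ID Lk Lh, ID Lj etaL, ID Li Lg, ID La Lf, ID gL Lb, ID G2L Lc, ID Ld Le, IZ)//.
  by rewrite gs0 u1; congr (_%:E); ring.
rewrite LE Lambda_phi /sqnormH1m !sqnormH_cof uW vW sqnormL2_cof.
rewrite !integral_EFinR// -EFinB -!EFinD -EFinM lee_fin.
have e0 : 0 <= \int[lebesgue_measure]_x eta x ^+ 2.
  by apply: Rintegral_ge0 => x _; exact: sqr_ge0.
have arith (a b c d e s : R) : a + b <= 7 * (b - 2 * a) -> c + d <= 7 * (d - 2 * c) ->
    0 <= e -> 7^-1 * (a + b + (c + d) + e) <=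
    2 * s + (b - 2 * a) + (d - 2 * c) + e - 2 * s.
  by clear; lra.
exact: arith cu cv e0.
Qed.
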